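(* Let $\mathcal{F}_{nn}$ be the class of depth-$d$ neural networks with parameters in a given parameter set ($\mathcal{W}_F$ or $\mathcal{W}_{1,\infty}$), whose activation functions satisfy Assumptions A and B of the context. Let $\mu,\nu\in\mathcal{P}_{B}$, let $\hat\mu_n,\hat\nu_m$ be their empirical measures, and let $\delta\in(0,1)$. (I) If the parameter set is $\mathcal{W}_F$ and each activation function satisfies $\sigma_i(\alpha x)=\alpha\sigma_i(x)$ for all $\alpha>0$ and $x\in\mathbb{R}$, then with probability at least $1-\delta$ over the randomness of $\hat\mu_n$ and $\hat\nu_m$, $$|d_{\mathcal{F}_{nn}}(\mu,\nu)-d_{\mathcal{F}_{nn}}(\hat\mu_n,\hat\nu_m)|\le\sqrt2\,\Gamma_{B}\prod_{i=1}^dM_F(i)\prod_{i=1}^{d-1}L_i\left(2\sqrt{d\log2}+\sqrt{\log(1/\delta)}+\sqrt2\right)\left(n^{-1/2}+m^{-1/2}\right).$$ (II) If the parameter set is $\mathcal{W}_{1,\infty}$ and each activation function satisfies $\sigma_i(0)=0$, then with probability at least $1-\delta$ over the randomness of $\hat\mu_n$ and $\hat\nu_m$, $$|d_{\mathcal{F}_{nn}}(\mu,\nu)-d_{\mathcal{F}_{nn}}(\hat\mu_n,\hat\nu_m)|\le\Gamma_{B}\prod_{i=1}^dM_{1,\infty}(i)\prod_{i=1}^{d-1}L_i\left(4\sqrt{d+1+\log h}+\sqrt{2\log(1/\delta)}\right)\left(n^{-1/2}+m^{-1/2}\right).$$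
   Context: Fix integers $h\ge1$ (input dimension), $d\ge2$ (depth), layer widths $k_1=h,k_2,\dots,k_d\ge1$, and sample sizes $n,m\ge1$. For a matrix $\mathbf{W}$, $\|\mathbf{W}\|_F$ is the Frobenius norm and $\|\mathbf{W}\|_{1,\infty}$ is the maximal $\ell_1$ norm of its rows; $\|\cdot\|$ on vectors is the $\ell_2$ norm and $\|\cdot\|_1$ the $\ell_1$ norm. $\log$ is the natural logarithm. Networks: a depth-$d$ neural network is a function of the form $f(\mathbf{x})=\mathbf{w}_d^T\sigma_{d-1}(\mathbf{W}_{d-1}\sigma_{d-2}(\cdots\sigma_1(\mathbf{W}_1\mathbf{x})))$, $\mathbf{x}\in\mathbb{R}^h$, where $\mathbf{W}_i\in\mathbb{R}^{k_{i+1}\times k_i}$ for $i=1,\dots,d-1$, $\mathbf{w}_d\in\mathbb{R}^{k_d}$, and the scalar activation functions $\sigma_i:\mathbb{R}\to\mathbb{R}$ (fixed) are applied entrywise. Given positive constants $M_F(i)$, $M_{1,\infty}(i)$, $i=1,\dots,d$, the parameter sets are: $\mathcal{W}_F$, all $(\mathbf{W}_1,\dots,\mathbf{W}_{d-1},\mathbf{w}_d)$ with $\|\mathbf{W}_i\|_F\le M_F(i)$ for $i\le d-1$ and $\|\mathbf{w}_d\|\le M_F(d)$; and $\mathcal{W}_{1,\infty}$, all such tuples with $\|\mathbf{W}_i\|_{1,\infty}\le M_{1,\infty}(i)$ for $i\le d-1$ and $\|\mathbf{w}_d\|_1\le M_{1,\infty}(d)$. $\mathcal{F}_{nn}$ is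 the set of all such networks with parameters in the given parameter set. Assumption A: each $\sigma_i$ is continuous, non-decreasing, satisfies $\sigma_i(0)\ge0$, and is $L_i$-Lipschitz with $L_i>0$ (these are the $L_i$ in the claim). Assumption B: for each $i=1,\dots,d-1$ there are positive constants $q(i)$ and $Q_\sigma(i)$ such that $\sigma_i(x_2)-\sigma_i(x_1)\ge Q_\sigma(i)(x_2-x_1)$ for all $0\le x_1\le x_2\le q(i)$. Neural net distance: $d_{\mathcal{F}_{nn}}(\mu,\nu)=\sup_{f\in\mathcal{F}_{nn}}|\mathbb{E}_{\mathbf{x}\sim\mu}f(\mathbf{x})-\mathbb{E}_{\mathbf{x}\sim\nu}f(\mathbf{x})|$. Class $\mathcal{P}_B$: given $\Gamma_B>0$, $\mathcal{P}_B$ is the set of all Borel probability measures supported in $\{\mathbf{x}\in\mathbb{R}^h:\|\mathbf{x}\|\le\Gamma_B\}$. Empirical measures: $\hat\mu_n$ puts mass $1/n$ on each of $n$ i.i.d. samples from $\mu$, and $\hat\nu_m$ puts mass $1/m$ on each of $m$ i.i.d. samples from $\nu$, the two samples being independent of each other. *)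

(* Defs.v *)
From HB Require Import structures.
From mathcomp Require Import all_boot all_order all_algebra.
From mathcomp Require Import all_classical all_reals all_analysis.

Set Implicit Arguments.
Unset Strict Implicit.
Unset Printing Implicit Defensive.

Import Order.TTheory GRing.Theory Num.Theory.
Import numFieldNormedType.Exports.

Local Open Scope classical_set_scope.
Local Open Scope ring_scope.

(* R^h with its Borel sigma-algebra; the topology of 'cV[R]_h is that of the
   sup norm, i.e. the usual one. *)
Definition borel_cV (R : realType) (h : nat) :=
  g_sigma_algebraType (@open 'cV[R]_h).

(* The library norm `|A| on matrices is the entrywise sup norm, so the norms
   below are spelled out. *)
Definition l2norm (R : realType) (h : nat) (x : 'cV[R]_h) : R :=
  Num.sqrt (\sum_(i < h) x i 0 ^+ 2).

Definition l1norm (R : realType) (h : nat) (x : 'cV[R]_h) : R :=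
  \sum_(i < h) `|x i 0|.

Definition frobenius (R : realType) (p q : nat) (A : 'M[R]_(p, q)) : R :=
  Num.sqrt (\sum_(i < p) \sum_(j < q) A i j ^+ 2).

Definition norm1oo (R : realType) (p q : nat) (A : 'M[R]_(p, q)) : R :=
  \big[Num.max/0]_(i < p) \sum_(j < q) `|A i j|.

(* A depth-d network with widths k 1, ..., k d has matrices W 1, ..., W d.-1
   (the other values of W are never used) and an output vector w_d.  For
   d > 0, d.-1.+1 is d; it is the row dimension of W d.-1 on the nose. *)
Definition parameters (R : realType) (d : nat) (k : nat -> nat) : Type :=
  ((forall i : nat, 'M[R]_(k i.+1, k i)) * 'cV[R]_(k d.-1.+1))%type.

Definition W_F (R : realType) (d : nat) (k : nat -> nat) (M : nat -> R) :
    set (parameters R d k) :=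
  [set p | (forall i, (1 <= i < d)%N -> frobenius (p.1 i) <= M i)
           /\ l2norm p.2 <= M d].

Definition W_1oo (R : realType) (d : nat) (k : nat -> nat) (M : nat -> R) :
    set (parameters R d k) :=
  [set p | (forall i, (1 <= i < d)%N -> norm1oo (p.1 i) <= M i)
           /\ l1norm p.2 <= M d].

Fixpoint hidden (R : realType) (k : nat -> nat) (sigma : nat -> R -> R)
    (W : forall i : nat, 'M[R]_(k i.+1, k i)) (x : 'cV[R]_(k 1%N)) (l : nat) :
    'cV[R]_(k l.+1) :=
  if l is l'.+1 then map_mx (sigma l'.+1) (W l'.+1 *m hidden sigma W x l')
  else x.

Definition network (R : realType) (d : nat) (k : nat -> nat)
    (sigma : nat -> R -> R) (p : parameters R d k) (x : 'cV[R]_(k 1%N)) : R :=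
  (p.2^T *m hidden sigma p.1 x d.-1) 0 0.

Definition F_nn (R : realType) (d : nat) (k : nat -> nat)
    (sigma : nat -> R -> R) (params : set (parameters R d k)) :
    set ('cV[R]_(k 1%N) -> R) :=
  network sigma @` params.

Definition assumption_A (R : realType) (d : nat) (sigma : nat -> R -> R)
    (L : nat -> R) : Prop :=
  forall i, (1 <= i < d)%N ->
    [/\ continuous (sigma i), {homo sigma i : x y / x <= y}, 0 <= sigma i 0,
        0 < L i & (L i).-lipschitz (sigma i)].

Definition assumption_B (R : realType) (d : nat) (sigma : nat -> R -> R) :
    Prop :=
  forall i, (1 <= i < d)%N -> exists q Q : R, [/\ 0 < q, 0 < Q &
    forall x1 x2 : R, 0 <= x1 -> x1 <= x2 -> x2 <= q ->
      Q * (x2 - x1) <= sigma i x2 - sigma i x1].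

(* The supremum is taken in the extended reals, so no boundedness is needed;
   the integrals are the expectations when mu and nu are probabilities. *)
Definition nn_distance (R : realType) (h : nat) (F : set ('cV[R]_h -> R))
    (mu nu : {measure set (borel_cV R h) -> \bar R}) : \bar R :=
  ereal_sup [set `|\int[mu]_x (f x)%:E - \int[nu]_x (f x)%:E|%E | f in F].

Definition P_B (R : realType) (h : nat) (GammaB : R) :
    set (probability (borel_cV R h) R) :=
  [set mu | mu [set x | l2norm x <= GammaB] = 1%E].

Section empirical_measure.
Context (R : realType) (h n : nat) (x : 'I_n -> borel_cV R h).

Definition empirical (A : set (borel_cV R h)) : \bar R :=
  ((n%:R^-1)%:E * \sum_(i < n) \d_(x i) A)%E.

Let empirical0 : empirical set0 = 0%E.
Proof. by rewrite /empirical big1 ?mule0// => i _; rewrite measure0. Qed.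

Let empirical_ge0 A : (0 <= empirical A)%E.
Proof. by rewrite mule_ge0 ?lee_fin ?invr_ge0// sume_ge0. Qed.

Let empirical_sigma_additive : semi_sigma_additive empirical.
Proof.
move=> F mF tF mUF; rewrite /empirical.
pose d j := if insub j is Some i then dirac (x i) : {measure set _ -> \bar R}
            else mzero.
have E A : (\sum_(i < n) \d_(x i) A)%E = msum d n A.
  by rewrite /msum; apply: eq_bigr => i _; rewrite /d valK.
under eq_fun do under eq_bigr do rewrite E.
rewrite E.
have n0 : 0 <= n%:R^-1 :> R by rewrite invr_ge0.
exact: (@measure_semi_sigma_additive _ _ _ (mscale (NngNum n0) (msum d n)) F).
Qed.

HB.instance Definition _ := isMeasure.Build _ _ _ empirical
  empirical0 empirical_ge0 empirical_sigma_additive.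

End empirical_measure.

Definition mutually_independent (R : realType) (dO dT : measure_display)
    (Omega : measurableType dO) (T : measurableType dT) (I : finType)
    (P : probability Omega R) (Z : I -> Omega -> T) : Prop :=
  forall (J : {set I}) (A : I -> set T),
    (forall i, i \in J -> measurable (A i)) ->
    P (\bigcap_(i in [set` J]) Z i @^-1` A i) =
    (\prod_(i in J) P (Z i @^-1` A i))%E.

Definition independent_samples (R : realType) (dO dT : measure_display)
    (Omega : measurableType dO) (T : measurableType dT)
    (P : probability Omega R) (mu nu : probability T R) (n m : nat)
    (X : 'I_n -> {mfun Omega >-> T}) (Y : 'I_m -> {mfun Omega >-> T}) : Prop :=
  [/\ forall i A, measurable A -> distribution P (X i) A = mu A,
      forall j A, measurable A -> distribution P (Y j) A = nu A &
      mutually_independent P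
        (fun s : 'I_n + 'I_m =>
           match s with inl i => X i : Omega -> T | inr j => Y j end)].

(* P is unspecified on non-measurable sets, hence the first conjunct. *)
Definition with_probability_at_least (R : realType) (dO : measure_display)
    (Omega : measurableType dO) (P : probability Omega R) (p : R)
    (E : set Omega) : Prop :=
  measurable E /\ (p%:E <= P E)%E.

(* Main.v *)
Require Import Defs.
From HB Require Import structures.
From mathcomp Require Import all_boot all_order all_algebra.
From mathcomp Require Import all_classical all_reals all_analysis.
From mathcomp Require Import measurable_realfun.
From mathcomp Require Import ring lra.

Import Order.TTheory GRing.Theory Num.Theory.
Import numFieldNormedType.Exports.

Local Open Scope classical_set_scope.
Local Open Scope ring_scope.

(* All n + m sample points are treated at once, with weights 1/n and -1/m.
   The supremum over networks of the deviation between weighted population and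
   sample means changes by at most 2 C |weight| when one point moves, where C
   bounds the networks on the ball, so McDiarmid's inequality (through
   Hoeffding's lemma) controls it up to its expectation.
   Symmetrization bounds the expectation by twice a Rademacher average, which is
   estimated, following Golowich, Rakhlin and Shamir, by peeling: inside an
   exponential moment a layer can be replaced by a single neuron, whose
   activation is removed by the contraction principle at the cost of a factor 2,
   so that d - 1 layers cost only (d - 1) log 2 in the exponent.
   Measure theory is reduced to finite sums: networks are uniformly Lipschitz, so
   the ball may be cut into finitely many small cells on which the i.i.d. samples
   have a finite product law; letting the mesh tend to 0 gives the result, and
   the same approximation shows that the suprema are measurable. *)

Set Implicit Arguments.
Unset Strict Implicit.

(** * Hoeffding's lemma *)

(** The two parameter sets differ only through their norms, so peeling is done once for abstract
    norms. The geometry enters through the one-neuron property and a constant [K0], which is 1 for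
    the Euclidean norm and the dimension for the sup norm; hence [log h] in the second bound only.
    The factor 2 per layer is due to absolute values: contraction handles signed sums, and
    [e^|S| <= e^S + e^(-S)]. The output layer is linear and costs no factor. Suprema are kept out of
    the expectations over signs: a bound is proved for every choice of a network as a function of
    the signs, so attainment is never an issue. Let [K = 2^(d-1) K0], and let [w] be the product of
    the radius, the Lipschitz constant and the l2 norm of the weights. The Rademacher average is at
    most [w (sqrt (2 ln K) + 1)], where the 1 comes from the mean norm of a Rademacher sum.
    Symmetrization doubles this, and McDiarmid adds [w sqrt (2 ln (1/delta))]. The weights have l2
    norm [sqrt (1/n + 1/m)], at most [n^(-1/2) + m^(-1/2)]. *)

Lemma le_of_derive_ge0 (R : realType) (f f' : R -> R) (x : R) :
  (forall y : R, 0 <= y -> is_derive y (1 : R) f (f' y)) ->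
  (forall y, 0 <= y -> 0 <= f' y) -> 0 <= x -> f 0 <= f x.
Proof.
move=> df f'_ge0 x0.
apply: (@ger0_derive1_ndecry R f 0) => //.
- move=> y; rewrite in_itv/= andbT => y0.
  by have /@ex_derive := df y (ltW y0).
- move=> y; rewrite in_itv/= andbT => y0.
  by rewrite derive1E (@derive_val _ _ _ _ _ _ _ (df y (ltW y0))) f'_ge0// ltW.
- apply: derivable_within_continuous => y; rewrite in_itv/= andbT => y0.
  by have /@ex_derive := df y y0.
Qed.

(* On [u >= 0], the logarithm of the left-hand side has second derivative
   [r (1 - r) <= 1/4] where [r = q e^u / (1 - q + q e^u)]. *)
Lemma bernoulli_mgf_le (R : realType) (q u : R) :
  0 <= q <= 1 -> 0 <= u ->
  1 - q + q * expR u <= expR (q * u + u ^+ 2 / 8).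
Proof.
move=> /andP[q0 q1] u0.
pose p (v : R) : R := 1 - q + q * expR v.
have p_ge1 (v : R) : 0 <= v -> 1 <= p v.
  move=> v0; have e1 : 1 <= expR v by rewrite -expR0 ler_expR.
  rewrite /p; nra.
have p_gt0 (v : R) : 0 <= v -> 0 < p v by move=> /p_ge1; apply: lt_le_trans.
have dp (v : R) : is_derive v (1 : R) p (q * expR v).
  have -> : p = cst (1 - q) + q *: (expR : R -> R) by [].
  have D := is_deriveD (is_derive_cst (1 - q) v 1) (is_deriveZ q (is_derive_expR v)).
  by rewrite add0r in D.
(* [k] is the derivative of [g] below, with [1 - (1 - q) / p v] equal to the ratio [r]. Both [k] and
   [g] vanish at 0, so nonnegativity passes from [k'] to [k] and then to [g]. *)
pose k (v : R) : R := q + v / 4 - (1 - (1 - q) / p v).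
have k_ge0 (v : R) : 0 <= v -> 0 <= k v.
  move=> v0; have k0 : k 0 = 0.
    by rewrite /k /p expR0 mulr1 subrK divr1; ring.
  rewrite -k0.
  pose k' (y : R) := 4^-1 - (1 - q) * (q * expR y) / p y ^+ 2.
  apply: (@le_of_derive_ge0 _ k k' v) v0 => y y0; rewrite /k'.
    have D := is_deriveD (is_deriveD (is_derive_cst (q - 1) y 1)
      (is_deriveZ 4^-1 (is_derive_id y 1)))
      (is_deriveZ (1 - q) (@is_deriveV R p y _ _ (lt0r_neq0 (p_gt0 _ y0)) (dp y))).
    have -> : k = cst (q - 1) + 4^-1 \*: id + (1 - q) \*: (fun z => (p z)^-1).
      apply/funext => z; rewrite /k; set w := p z.
      change (q + z / 4 - (1 - (1 - q) / w) = (q - 1) + 4^-1 * z + (1 - q) * w^-1).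
      by ring.
    apply: (is_derive_eq D); rewrite add0r.
    change (4^-1 * 1 + (1 - q) * (- p y ^- 2 * (q * expR y)) =
            4^-1 - (1 - q) * (q * expR y) / p y ^+ 2).
    by ring.
  have py0 := p_gt0 _ y0.
  rewrite subr_ge0 ler_pdivrMr ?exprn_gt0//.
  have e0 : 0 < expR y := expR_gt0 y.
  (* This square is the inequality [4 (1 - q) q e^y <= p(y)^2], that is [r (1 - r) <= 1/4]. *)
  have := sqr_ge0 ((1 - q) - q * expR y).
  rewrite /p; lra.
pose g (v : R) : R := q * v + v ^+ 2 / 8 - ln (p v).
have g_ge0 : 0 <= g u.
  have g0 : g 0 = 0 by rewrite /g /p expR0 mulr1 subrK ln1; ring.
  rewrite -g0; apply: (@le_of_derive_ge0 _ g k u _ k_ge0 u0) => y y0.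
  have dl := is_derive1_comp (is_derive1_ln (p_gt0 _ y0)) (dp y).
  have D := is_deriveB (is_deriveD (is_deriveZ q (is_derive_id y 1))
    (is_deriveZ 8^-1 (is_deriveX 2 (is_derive_id y 1)))) dl.
  have -> : g = q \*: id + 8^-1 \*: (id ^+ 2) - (@ln R \o p).
    apply/funext => z; rewrite /g; set w := ln (p z).
    change (q * z + z ^+ 2 / 8 - w = q * z + 8^-1 * (z * z) - w).
    by ring.
  apply: (is_derive_eq D).
  rewrite /GRing.scale/= /k expr1.
  have : p y != 0 by rewrite gt_eqF ?p_gt0.
  rewrite /p => pn; field => //.
rewrite -(@lnK _ (1 - q + q * expR u)) ?posrE ?p_gt0// ler_expR.
by rewrite -subr_ge0.
Qed.

(** * McDiarmid's inequality for finite product distributions *)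

(** The tangent to exp at [u * t] lies below exp at 0 and at [u]; averaging these two inequalities
    with weights [1 - t] and [t] cancels the slope. *)
Lemma expR_chord (R : realType) (u t : R) : 0 <= t <= 1 ->
  expR (u * t) <= 1 - t + t * expR u.
Proof.
move=> /andP[t0 t1].
have e0 : 0 < expR (u * t) := expR_gt0 _.
have h1 : expR (u * t) * (1 - u * t) <= 1.
  rewrite -[X in _ <= X]expR0 -[in X in _ <= X](subrr (u * t)) expRD ler_pM2l//.
  exact: expR_ge1Dx.
have h2 : expR (u * t) * (1 + (u - u * t)) <= expR u.
  rewrite -[in X in _ <= X](subrKC (u * t) u) expRD ler_pM2l//.
  exact: expR_ge1Dx.
nra.
Qed.

Definition pmf (R : realType) (C : finType) (w : C -> R) : Prop :=
  (forall a, 0 <= w a) /\ \sum_a w a = 1.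

(** Rescaled to the unit interval, [Y] may be replaced by a Bernoulli variable of the same mean [q],
    by convexity of exp; then [bernoulli_mgf_le] applies at [u = l * c]. *)
Lemma hoeffding_mgf (R : realType) (C : finType) (w Y : C -> R) (c l : R) :
  pmf w -> 0 <= l -> (forall a b, Y a - Y b <= c) ->
  \sum_a w a * expR (l * (Y a - \sum_b w b * Y b)) <= expR (l ^+ 2 * c ^+ 2 / 8).
Proof.
move=> [w0 w1] l0 Yc.
have [a1 _|C0] := pickP (@predT C); last first.
  by move: w1; rewrite big_pred0//= => /eqP; rewrite eq_sym oner_eq0.
have [a0 _ a0min] := Order.TotalTheory.arg_minP Y (isT : predT a1).
set m := Y a0 in a0min.
have c0 : 0 <= c by have := Yc a0 a0; rewrite subrr.
(* If [c = 0] then [Y] is constant, and division by 0 returns 0, so [Y a - m = c * t a] still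
   holds. *)
pose t a := (Y a - m) / c.
have tc a : Y a - m = c * t a.
  rewrite /t; have [c_0|cn0] := eqVneq c 0; last by rewrite mulrCA divff// mulr1.
  have := Yc a a0; have := a0min a isT; rewrite c_0 -/m mul0r; lra.
have t01 a : 0 <= t a <= 1.
  rewrite /t; have [->|cn0] := eqVneq c 0; first by rewrite invr0 mulr0 lexx ler01.
  have cp : 0 < c by rewrite lt_neqAle eq_sym cn0.
  by rewrite divr_ge0 ?subr_ge0 ?a0min//= ler_pdivrMr// mul1r Yc.
pose q := \sum_b w b * t b.
have EY : \sum_b w b * Y b = m + c * q.
  rewrite -[m]mulr1 -w1 !mulr_sumr -big_split/=; apply: eq_bigr => a _.
  have -> : Y a = m + c * t a by rewrite -tc addrC subrK.
  by ring.
have q01 : 0 <= q <= 1.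
  apply/andP; split.
    by apply: sumr_ge0 => a _; rewrite mulr_ge0//; case/andP: (t01 a).
  rewrite -w1; apply: ler_sum => a _; rewrite -[leRHS]mulr1 ler_wpM2l//.
  by case/andP: (t01 a).
apply: (@le_trans _ _ (expR (- (l * c) * q) * (1 - q + q * expR (l * c)))).
  have -> : 1 - q + q * expR (l * c) =
            \sum_a w a * (1 - t a + t a * expR (l * c)).
    transitivity (\sum_a (w a - w a * t a + w a * t a * expR (l * c))).
      by rewrite big_split/= sumrB -mulr_suml w1.
    by apply: eq_bigr => a _; ring.
  rewrite mulr_sumr; apply: ler_sum => a _.
  rewrite mulrCA ler_wpM2l// EY.
  have -> : l * (Y a - (m + c * q)) = - (l * c) * q + (l * c) * t a.
    by rewrite -[Y a](subrK m) tc; ring.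
  by rewrite expRD ler_wpM2l ?expR_ge0// expR_chord.
rewrite -[leRHS](_ : expR (- (l * c) * q) * expR (q * (l * c) + (l * c) ^+ 2 / 8) = _).
  by rewrite ler_wpM2l ?expR_ge0// bernoulli_mgf_le// mulr_ge0.
by rewrite -expRD; congr expR; ring.
Qed.

(** Expectation under the product of [p 0], ..., [p N.-1], integrated one coordinate at a time so
    that conditioning on the first coordinate is definitional. The laws may differ, as two
    populations will be pooled. *)
Fixpoint prodE (R : realType) (C : finType) (p : nat -> C -> R) (N : nat)
    (g : seq C -> R) : R :=
  if N is N'.+1 then
    \sum_c p 0%N c * prodE (fun i => p i.+1) N' (fun s => g (c :: s))
  else g [::].

Section prodE_theory.
Context (R : realType) (C : finType).
Implicit Types (p : nat -> C -> R) (f g : seq C -> R).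

Lemma eq_prodE p N f g : (forall s, size s = N -> f s = g s) ->
  prodE p N f = prodE p N g.
Proof.
elim: N p f g => [|N IH] p f g fg; first exact: fg.
apply: eq_bigr => c _; congr (_ * _); apply: IH => s sN.
by apply: fg; rewrite /= sN.
Qed.

Lemma ler_prodE p N f g : (forall i, pmf (p i)) ->
  (forall s, size s = N -> f s <= g s) -> prodE p N f <= prodE p N g.
Proof.
elim: N p f g => [|N IH] p f g pp fg; first exact: fg.
apply: ler_sum => c _; rewrite ler_wpM2l//; first by case: (pp 0%N).
by apply: IH => [i|s sN]; [exact: pp|apply: fg; rewrite /= sN].
Qed.

Lemma prodE_cst p N (k : R) : (forall i, pmf (p i)) ->
  prodE p N (fun=> k) = k.
Proof.
elim: N p => [//|N IH] p pp /=.
under eq_bigr do rewrite IH//.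
by rewrite -mulr_suml; case: (pp 0%N) => _ ->; rewrite mul1r.
Qed.

Lemma prodED p N f g :
  prodE p N (fun s => f s + g s) = prodE p N f + prodE p N g.
Proof.
elim: N p f g => [//|N IH] p f g /=.
by rewrite -big_split/=; apply: eq_bigr => c _; rewrite IH mulrDr.
Qed.

Lemma prodEZ p N (k : R) f : prodE p N (fun s => k * f s) = k * prodE p N f.
Proof.
elim: N p f => [//|N IH] p f /=.
by rewrite mulr_sumr; apply: eq_bigr => c _; rewrite IH mulrCA.
Qed.

Lemma prodE_sum p N (I : Type) (r : seq I) (F : I -> seq C -> R) :
  prodE p N (fun s => \sum_(i <- r) F i s) = \sum_(i <- r) prodE p N (F i).
Proof.
elim: N p F => [//|N IH] p F /=.
by under eq_bigr do rewrite IH mulr_sumr; rewrite exchange_big.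
Qed.

Lemma prodE_ge0 p N f : (forall i, pmf (p i)) ->
  (forall s, size s = N -> 0 <= f s) -> 0 <= prodE p N f.
Proof. by move=> pp f0; rewrite -(prodE_cst N 0 pp); exact: ler_prodE. Qed.

(** The tangent line of exp at the mean [m] lies below exp and has expectation [exp m]. *)
Lemma prodE_jensen_exp p N f : (forall i, pmf (p i)) ->
  expR (prodE p N f) <= prodE p N (fun s => expR (f s)).
Proof.
move=> pp; set m := prodE p N f.
have -> : expR m = prodE p N (fun s => expR m * (1 + (f s + - m))).
  by rewrite prodEZ !prodED !prodE_cst// subrr addr0 mulr1.
apply: ler_prodE => // s _.
rewrite -[in leRHS](subrKC m (f s)) expRD ler_wpM2l ?expR_ge0//.
exact: expR_ge1Dx.
Qed.

Lemma prodE_jensen_sqr p N f : (forall i, pmf (p i)) ->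
  (prodE p N f) ^+ 2 <= prodE p N (fun s => f s ^+ 2).
Proof.
move=> pp; set m := prodE p N f.
have -> : m ^+ 2 = prodE p N (fun s => 2 * m * f s + - m ^+ 2).
  by rewrite prodED prodEZ prodE_cst// -/m; ring.
apply: ler_prodE => // s _; have := sqr_ge0 (f s - m); lra.
Qed.

(** The martingale argument, as an induction: the conditional mean [Y] given the first coordinate
    varies by at most [c 0], so Hoeffding's lemma applies to it, while the induction hypothesis
    treats the other coordinates with the first one frozen. *)
Lemma mcdiarmid_mgf p N (c : nat -> R) g (l : R) : (forall i, pmf (p i)) ->
  0 <= l ->
  (forall s1 s2 a b, (size s1 + size s2).+1 = N ->
     g (s1 ++ a :: s2) - g (s1 ++ b :: s2) <= c (size s1)) ->
  prodE p N (fun s => expR (l * (g s - prodE p N g))) <=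
  expR (l ^+ 2 * (\sum_(i < N) c i ^+ 2) / 8).
Proof.
move=> + l0; elim: N p c g => [|N IH] p c g pp gc.
  by rewrite big_ord0 mulr0 mul0r /= subrr mulr0.
set m := prodE p N.+1 g; rewrite /=.
pose Y a := prodE (fun i => p i.+1) N (fun s => g (a :: s)).
have pp' i : pmf (p i.+1) by exact: pp.
apply: (@le_trans _ _ (\sum_a p 0%N a * expR (l * (Y a - m)) *
    expR (l ^+ 2 * (\sum_(i < N) c i.+1 ^+ 2) / 8))).
  apply: ler_sum => a _; rewrite -mulrA ler_wpM2l//; first by case: (pp 0%N).
  rewrite (@eq_prodE _ N _ (fun s =>
    expR (l * (Y a - m)) * expR (l * (g (a :: s) - Y a)))); last first.
    by move=> s _; rewrite -expRD; congr expR; ring.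
  rewrite prodEZ ler_wpM2l ?expR_ge0//.
  apply: (IH _ (fun i => c i.+1) (fun s => g (a :: s))) => //.
  by move=> s1 s2 x y sN; apply: (gc (a :: s1)); rewrite /= addSn sN.
rewrite -mulr_suml big_ord_recl mulrDr mulrDl expRD ler_wpM2r ?expR_ge0//.
apply: hoeffding_mgf => // a b.
have -> : Y a - Y b = prodE (fun i => p i.+1) N
    (fun s => g (a :: s) + -1 * g (b :: s)).
  by rewrite prodED prodEZ mulN1r.
rewrite -(prodE_cst N (c 0%N) pp'); apply: ler_prodE => // s sN.
by rewrite mulN1r; apply: (gc [::]); rewrite /= sN.
Qed.

End prodE_theory.

(** * Contraction for Rademacher averages *)

(** A boolean [b] encodes the sign [(-1) ^+ b], so [true] stands for -1. *)
Definition signE (R : realType) (N : nat) (g : seq bool -> R) : R :=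
  prodE (fun _ _ => 2^-1) N g.

Lemma pmf_sign (R : realType) (i : nat) :
  pmf ((fun (_ : nat) (_ : bool) => 2^-1 : R) i).
Proof.
by split=> [_|]; [rewrite invr_ge0|rewrite big_bool/=; lra].
Qed.

Section sign_expectation.
Context (R : realType).
Implicit Types (N : nat) (f g : seq bool -> R).

Lemma signES N g : signE N.+1 g =
  2^-1 * (signE N (fun s => g (true :: s)) + signE N (fun s => g (false :: s))).
Proof. by rewrite /signE/= big_bool/= mulrDr. Qed.

Lemma eq_signE N f g : (forall s, size s = N -> f s = g s) ->
  signE N f = signE N g.
Proof. exact: eq_prodE. Qed.

Lemma ler_signE N f g : (forall s, size s = N -> f s <= g s) ->
  signE N f <= signE N g.
Proof. by apply: ler_prodE => i; exact: pmf_sign. Qed.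

Lemma signED N f g :
  signE N (fun s => f s + g s) = signE N f + signE N g.
Proof. exact: prodED. Qed.

Lemma signEZ N (k : R) f : signE N (fun s => k * f s) = k * signE N f.
Proof. exact: prodEZ. Qed.

End sign_expectation.

(** Convexity of exp: an increment grows with its base point as well as with its length. *)
Lemma expR_increment_le (R : realType) (x y g h : R) :
  x <= y -> 0 <= g -> g <= h ->
  expR (x + g) - expR x <= expR (y + h) - expR y.
Proof.
move=> xy g0 gh; rewrite !expRD.
have ey : expR x <= expR y by rewrite ler_expR.
have eg : expR g <= expR h by rewrite ler_expR.
have g1 : 1 <= expR g by rewrite -expR0 ler_expR.
have x0 : 0 < expR x := expR_gt0 x.
nra.
Qed.

(** Passing from [f] to [p] raises the first exponent by [p1 - f1] and lowers the second by
    [p2 - f2], which is no larger. The rise starts at the higher point, since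
    [a2 - p2 <= a2 + f2 <= a1 + f1], so it outweighs the drop. *)
Lemma expR_contraction_core (R : realType) (a1 a2 f1 f2 p1 p2 : R) :
  `|f1| <= p1 -> `|f2| <= p2 -> `|f1 - f2| <= p1 - p2 -> a2 + f2 <= a1 + f1 ->
  expR (a1 + f1) + expR (a2 - f2) <= expR (a1 + p1) + expR (a2 - p2).
Proof.
rewrite !ler_norml => /andP[h1 h2] /andP[h3 h4] /andP[h5 h6] h7.
have := @expR_increment_le _ (a2 - p2) (a1 + f1) (p2 - f2) (p1 - f1).
have -> : a2 - p2 + (p2 - f2) = a2 - f2 by ring.
have -> : a1 + f1 + (p1 - f1) = a1 + p1 by ring.
move=> H; have := H ltac:(lra) ltac:(lra) ltac:(lra); lra.
Qed.

(** The comparison for one random sign, with suprema replaced by a pair of points. The new points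
    may be the old ones, the old ones exchanged, or one of them taken twice. *)
Lemma expR_contraction (R : realType) (T : Type) (A f p : T -> R) (t s : T) :
  (forall x, `|f x| <= `|p x|) -> (forall x y, `|f x - f y| <= `|p x - p y|) ->
  exists t' s', expR (A t + f t) + expR (A s - f s) <=
                expR (A t' + p t') + expR (A s' - p s').
Proof.
move=> fp fpB.
have diag x : expR (A x + f x) + expR (A x - f x) <=
              expR (A x + p x) + expR (A x - p x).
  have := fp x; have [p0|p0] := leP 0 (p x); last first.
    rewrite (ltr0_norm p0) => h; rewrite [leRHS]addrC.
    have := @expR_contraction_core _ (A x) (A x) (f x) (f x) (- p x) (- p x).
    by rewrite !subrr normr0 opprK; apply.
  rewrite (ger0_norm p0) => h.
  by apply: expR_contraction_core => //; rewrite ?subrr ?normr0.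
(* If one point is beaten by the other in its own exponent, using the better point twice only
   increases the sum, and [diag] concludes. The remaining case has exactly the orderings that
   [expR_contraction_core] asks for. *)
have [lt1|le1] := ltP (A t + f t) (A s + f s).
  by exists s, s; apply: le_trans (diag s); rewrite lerD2r ler_expR ltW.
have [lt2|le2] := ltP (A s - f s) (A t - f t).
  by exists t, t; apply: le_trans (diag t); rewrite lerD2l ler_expR ltW.
have ndist x y : `|- f x - - f y| = `|f y - f x| by rewrite opprK addrC.
have ft := fp t; have fs := fp s; have fts := fpB t s.
have [pt|pt] := leP 0 (p t); have [ps|ps] := leP 0 (p s).
- rewrite (ger0_norm pt) in ft; rewrite (ger0_norm ps) in fs.
  have [pst|pts] := leP (p s) (p t).
    exists t, s; apply: expR_contraction_core => //.
    by rewrite (le_trans fts)// ger0_norm ?subr_ge0.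
  have := @expR_contraction_core _ (A s) (A t) (- f s) (- f t) (p s) (p t).
  have {}fts : `|f t - f s| <= p s - p t.
    by rewrite (le_trans fts)// ltr0_norm ?subr_lt0// opprB.
  rewrite ndist !normrN opprK => H.
  by exists s, t; rewrite addrC; exact: H.
(* When [p t] and [p s] have opposite signs, each exponential is bounded on its own, after
   exchanging the points if [p t] is the negative one. *)
- rewrite (ger0_norm pt) in ft; rewrite (ltr0_norm ps) in fs.
  exists t, s; move: ft fs; rewrite !ler_norml => /andP[? ?] /andP[? ?].
  by apply: lerD; rewrite ler_expR; lra.
- rewrite (ltr0_norm pt) in ft; rewrite (ger0_norm ps) in fs.
  exists s, t; move: ft fs; rewrite !ler_norml => /andP[? ?] /andP[? ?].
  by rewrite addrC; apply: lerD; rewrite ler_expR; lra.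
- rewrite (ltr0_norm pt) in ft; rewrite (ltr0_norm ps) in fs.
  have [pst|pts] := leP (p s) (p t).
    have := @expR_contraction_core _ (A s) (A t) (- f s) (- f t) (- p s) (- p t).
    have {}fts : `|f t - f s| <= p t - p s by rewrite (le_trans fts)// ger0_norm ?subr_ge0.
    rewrite ndist !normrN !opprK (addrC (- p s)) => H.
    by exists t, s; rewrite addrC [leRHS]addrC; exact: H.
  have := @expR_contraction_core _ (A t) (A s) (f t) (f s) (- p t) (- p s).
  have {}fts : `|f t - f s| <= p s - p t.
    by rewrite (le_trans fts)// ltr0_norm ?subr_lt0// opprB.
  rewrite !opprK (addrC (- p t)) => H.
  by exists s, t; rewrite [leRHS]addrC; exact: H.
Qed.

(* Selections [t] of a parameter for each sign vector play the role of suprema: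
   bounding [E sup_x F(eps, x)] amounts to bounding [E F(eps, t eps)] for all
   [t]. *)
Lemma rademacher_contraction (R : realType) (T : Type) (N : nat)
    (u v : nat -> T -> R) (A : T -> R) (t : seq bool -> T) :
  (forall i x, `|u i x| <= `|v i x|) ->
  (forall i x y, `|u i x - u i y| <= `|v i x - v i y|) ->
  exists t' : seq bool -> T,
    signE N (fun s => expR (A (t s) +
      \sum_(i < N) (-1) ^+ nth false s i * u i (t s))) <=
    signE N (fun s => expR (A (t' s) +
      \sum_(i < N) (-1) ^+ nth false s i * v i (t' s))).
Proof.
elim: N u v A t => [|N IH] u v A t uv uvB.
  by exists t; rewrite /signE/= !big_ord0.
have shift (b : bool) s (w : nat -> T -> R) x :
    A x + \sum_(i < N.+1) (-1) ^+ nth false (b :: s) i * w i x =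
    (A x + (-1) ^+ b * w 0%N x) +
    \sum_(i < N) (-1) ^+ nth false s i * w i.+1 x.
  by rewrite big_ord_recl addrA.
(* With the first sign fixed, its term is absorbed into [A] and the induction hypothesis contracts
   the other coordinates. The two values of the first sign are then recombined, for each tail [s],
   by [expR_contraction]. *)
have step (b : bool) : exists r : seq bool -> T,
    signE N (fun s => expR (A (t (b :: s)) +
      \sum_(i < N.+1) (-1) ^+ nth false (b :: s) i * u i (t (b :: s)))) <=
    signE N (fun s => expR ((A (r s) +
      \sum_(i < N) (-1) ^+ nth false s i * v i.+1 (r s)) +
      (-1) ^+ b * u 0%N (r s))).
  have [r hr] := IH (fun i => u i.+1) (fun i => v i.+1)
    (fun x => A x + (-1) ^+ b * u 0%N x) (fun s => t (b :: s))
    (fun i => uv i.+1) (fun i => uvB i.+1).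
  exists r; apply: (le_trans (ler_signE _)) (le_trans hr (ler_signE _)).
    by move=> s _; rewrite shift.
  by move=> s _; rewrite addrAC.
have [r1 h1] := step true; have [r0 h0] := step false.
have pair s : exists q : T * T,
    expR ((A (r1 s) + \sum_(i < N) (-1) ^+ nth false s i * v i.+1 (r1 s)) +
      (-1) ^+ true * u 0%N (r1 s)) +
    expR ((A (r0 s) + \sum_(i < N) (-1) ^+ nth false s i * v i.+1 (r0 s)) +
      (-1) ^+ false * u 0%N (r0 s)) <=
    expR ((A q.1 + \sum_(i < N) (-1) ^+ nth false s i * v i.+1 q.1) +
      (-1) ^+ true * v 0%N q.1) +
    expR ((A q.2 + \sum_(i < N) (-1) ^+ nth false s i * v i.+1 q.2) +
      (-1) ^+ false * v 0%N q.2).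
  have [t' [s' h]] := @expR_contraction _ _
    (fun x => A x + \sum_(i < N) (-1) ^+ nth false s i * v i.+1 x)
    (u 0%N) (v 0%N) (r0 s) (r1 s) (uv 0%N) (uvB 0%N).
  exists (s', t'); rewrite /= expr1 expr0 !mul1r !mulN1r.
  by rewrite addrC [leRHS]addrC.
have [q hq] := choice pair.
exists (fun s => if s is b :: s' then if b then (q s').1 else (q s').2
                 else t s).
rewrite !signES ler_pM2l ?invr_gt0//.
apply: (le_trans (lerD h1 h0)); rewrite -!signED.
apply: ler_signE => s _; apply: (le_trans (hq s)).
by rewrite !shift ![_ + \sum_(i < N) _ + _]addrAC.
Qed.

(** * Rademacher sums of vectors *)

Lemma sum_sqr_ge0 (R : realType) (I : finType) (u : I -> R) :
  0 <= \sum_i u i ^+ 2.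
Proof. by apply: sumr_ge0 => i _; exact: sqr_ge0. Qed.

(** For [b <> 0], from [0 <= \sum_i (b * u i - c * v i) ^+ 2 = b * (a * b - c ^+ 2)]. *)
Lemma cauchy_schwarz_sum (R : realType) (I : finType) (u v : I -> R) :
  `|\sum_i u i * v i| <=
  Num.sqrt (\sum_i u i ^+ 2) * Num.sqrt (\sum_i v i ^+ 2).
Proof.
set a := \sum_i u i ^+ 2; set b := \sum_i v i ^+ 2; set c := \sum_i u i * v i.
have a0 : 0 <= a := sum_sqr_ge0 u.
have b0 : 0 <= b := sum_sqr_ge0 v.
rewrite -sqrtrM// -sqrtr_sqr ler_wsqrtr//.
have [b_0|bn0] := eqVneq b 0.
  have v0 i : v i = 0.
    apply/eqP; rewrite -sqrf_eq0; apply/eqP.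
    by apply: (psumr_eq0P (P := xpredT)) b_0 i isT => j _; exact: sqr_ge0.
  by rewrite /c big1 ?expr0n ?mulr_ge0// => i _; rewrite v0 mulr0.
have bp : 0 < b by rewrite lt_neqAle eq_sym bn0.
have : 0 <= b * (a * b - c ^+ 2).
  have -> : b * (a * b - c ^+ 2) = \sum_i (b * u i - c * v i) ^+ 2.
    transitivity (\sum_i (b ^+ 2 * u i ^+ 2 + (- (2 * b * c)) * (u i * v i)
                          + c ^+ 2 * v i ^+ 2)).
      by rewrite !big_split/= -!mulr_sumr -/a -/b -/c; ring.
    by apply: eq_bigr => i _; ring.
  exact: sum_sqr_ge0.
by rewrite pmulr_rge0// subr_ge0.
Qed.

Section l2norm_theory.
Context (R : realType) (h : nat).
Implicit Types x y : 'cV[R]_h.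

Lemma l2norm_ge0 x : 0 <= l2norm x.
Proof. exact: sqrtr_ge0. Qed.

Lemma l2norm_sqr x : l2norm x ^+ 2 = \sum_i x i 0 ^+ 2.
Proof. by rewrite sqr_sqrtr// sum_sqr_ge0. Qed.

Lemma l2norm0 : l2norm (0 : 'cV[R]_h) = 0.
Proof. by rewrite /l2norm big1 ?sqrtr0// => i _; rewrite mxE expr0n. Qed.

Lemma l2normZ (a : R) x : l2norm (a *: x) = `|a| * l2norm x.
Proof.
rewrite /l2norm -sqrtr_sqr -sqrtrM ?sqr_ge0// mulr_sumr.
by congr Num.sqrt; apply: eq_bigr => i _; rewrite mxE exprMn.
Qed.

Lemma l2normN x : l2norm (- x) = l2norm x.
Proof. by rewrite -scaleN1r l2normZ normrN1 mul1r. Qed.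

Lemma l2norm_dot x y : `|\sum_i x i 0 * y i 0| <= l2norm x * l2norm y.
Proof. exact: cauchy_schwarz_sum. Qed.

Lemma l2normD_sqr x y : l2norm (x + y) ^+ 2 =
  l2norm x ^+ 2 + 2 * (\sum_i x i 0 * y i 0) + l2norm y ^+ 2.
Proof.
rewrite !l2norm_sqr mulr_sumr -!big_split/=.
by apply: eq_bigr => i _; rewrite mxE; ring.
Qed.

Lemma ler_l2normD x y : l2norm (x + y) <= l2norm x + l2norm y.
Proof.
rewrite -(@ler_pXn2r _ 2)// ?nnegrE ?addr_ge0 ?l2norm_ge0//.
have := ler_normlW (l2norm_dot x y); rewrite l2normD_sqr; lra.
Qed.

Lemma l2norm_dist x y : `|l2norm x - l2norm y| <= l2norm (x - y).
Proof.
have h1 := ler_l2normD (x - y) y; have h2 := ler_l2normD (y - x) x.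
rewrite !subrK -(opprB x y) l2normN in h1 h2.
rewrite ler_norml; lra.
Qed.

Lemma coord_le_l2norm x i : `|x i 0| <= l2norm x.
Proof.
rewrite -sqrtr_sqr ler_wsqrtr// (bigD1 i)//= lerDl.
by apply: sumr_ge0 => j _; exact: sqr_ge0.
Qed.

End l2norm_theory.

Section rademacher_vector_sum.
Context (R : realType) (h : nat).
Implicit Types (x : nat -> 'cV[R]_h) (z : 'cV[R]_h).

Definition sign_sum N x (s : seq bool) : 'cV[R]_h :=
  \sum_(i < N) (-1) ^+ nth false s i *: x i.

Lemma sign_sumS N x b s :
  sign_sum N.+1 x (b :: s) = (-1) ^+ b *: x 0%N + sign_sum N (fun i => x i.+1) s.
Proof. by rewrite /sign_sum big_ord_recl. Qed.

(** The offset [z] makes the induction go through: the two values of the first sign turn it into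
    [z - x 0] and [z + x 0], and the parallelogram law cancels the cross terms. *)
Lemma signE_l2norm_sqr N x z :
  signE N (fun s => l2norm (z + sign_sum N x s) ^+ 2) =
  l2norm z ^+ 2 + \sum_(i < N) l2norm (x i) ^+ 2.
Proof.
elim: N x z => [|N IH] x z.
  by rewrite /signE/= /sign_sum !big_ord0 !addr0.
rewrite signES big_ord_recl.
rewrite (@eq_signE _ _ _ (fun s =>
  l2norm (z - x 0%N + sign_sum N (fun i => x i.+1) s) ^+ 2)); last first.
  by move=> s _; rewrite sign_sumS expr1 scaleN1r addrA.
rewrite [X in _ + X](@eq_signE _ _ _ (fun s =>
  l2norm (z + x 0%N + sign_sum N (fun i => x i.+1) s) ^+ 2)); last first.
  by move=> s _; rewrite sign_sumS expr0 scale1r addrA.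
rewrite !IH !l2normD_sqr l2normN.
have -> : \sum_i z i 0 * (- x 0%N) i 0 = - \sum_i z i 0 * x 0%N i 0.
  by rewrite -sumrN; apply: eq_bigr => i _; rewrite mxE mulrN.
by field.
Qed.

Lemma sign_sum_bounded_difference N x s1 s2 a b :
  (size s1 + size s2).+1 = N ->
  l2norm (sign_sum N x (s1 ++ a :: s2)) - l2norm (sign_sum N x (s1 ++ b :: s2))
  <= 2 * l2norm (x (size s1)).
Proof.
move=> sN; apply: (le_trans (ler_norm _)); apply: (le_trans (l2norm_dist _ _)).
have s1N : (size s1 < N)%N by rewrite -sN ltnS leq_addr.
rewrite /sign_sum -sumrB (bigD1 (Ordinal s1N))//= big1 => [|i].
  rewrite addr0 !nth_cat ltnn subnn/= -scalerBl l2normZ.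
  rewrite ler_wpM2r ?l2norm_ge0//.
  by case: a; case: b; rewrite ?expr0 ?expr1 ler_norml; lra.
move=> /negP in1; rewrite !nth_cat; have [lt|ge] := ltnP i (size s1).
  by rewrite subrr.
have : (0 < i - size s1)%N.
  rewrite subn_gt0 ltn_neqAle ge andbT; apply/negP => /eqP eq.
  by apply: in1; apply/eqP/val_inj.
by case: (i - size s1)%N => // k _; rewrite subrr.
Qed.

Lemma signE_l2norm_le N x :
  signE N (fun s => l2norm (sign_sum N x s)) <=
  Num.sqrt (\sum_(i < N) l2norm (x i) ^+ 2).
Proof.
rewrite -[leLHS]ger0_norm; last first.
  apply: prodE_ge0 => [i|s _]; [exact: pmf_sign|exact: l2norm_ge0].
rewrite -sqrtr_sqr ler_wsqrtr//.
apply: (le_trans (prodE_jensen_sqr _ _ _)); first exact: pmf_sign.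
have := signE_l2norm_sqr N x 0; rewrite l2norm0 expr0n/= add0r => <-.
by apply: ler_signE => s _; rewrite add0r.
Qed.

(** The norm has mean at most [sqrt V], and changing one sign moves it by at most
    [2 * l2norm (x i)]; McDiarmid then gives the exponent [l^2 * 4V / 8 = l^2 V / 2]. *)
Lemma signE_exp_l2norm_le N x (l V : R) : 0 <= l ->
  \sum_(i < N) l2norm (x i) ^+ 2 <= V ->
  signE N (fun s => expR (l * l2norm (sign_sum N x s))) <=
  expR (l ^+ 2 * V / 2 + l * Num.sqrt V).
Proof.
move=> l0 xV; set m := signE N (fun s => l2norm (sign_sum N x s)).
rewrite (@eq_signE _ _ _ (fun s => expR (l * m) *
    expR (l * (l2norm (sign_sum N x s) - m)))); last first.
  by move=> s _; rewrite -expRD; congr expR; ring.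
rewrite signEZ addrC expRD ler_pM ?expR_ge0//.
- by apply: prodE_ge0 => [i|s _]; [exact: pmf_sign|exact: expR_ge0].
- rewrite ler_expR ler_wpM2l//; apply: (le_trans (signE_l2norm_le _ _)).
  by rewrite ler_wsqrtr.
apply: (le_trans (@mcdiarmid_mgf _ _ _ _ (fun i => 2 * l2norm (x i)) _ _ _ l0 _)).
- exact: pmf_sign.
- exact: sign_sum_bounded_difference.
rewrite ler_expR (_ : \sum_(i < N) _ = 4 * \sum_(i < N) l2norm (x i) ^+ 2).
  have := ler_wpM2l (sqr_ge0 l) xV; lra.
by rewrite mulr_sumr; apply: eq_bigr => i _; rewrite exprMn; ring.
Qed.

End rademacher_vector_sum.

(** * Peeling a network layer by layer *)

Definition dotp (R : realType) (q : nat) (w v : 'cV[R]_q) : R :=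
  \sum_j w j 0 * v j 0.

Lemma dotp_sumr (R : realType) (q N : nat) (w : 'cV[R]_q) (c : nat -> R)
    (v : nat -> 'cV[R]_q) :
  dotp w (\sum_(i < N) c i *: v i) = \sum_(i < N) c i * dotp w (v i).
Proof.
under [RHS]eq_bigr do rewrite mulr_sumr.
rewrite exchange_big/=; apply: eq_bigr => j _.
rewrite summxE mulr_sumr; apply: eq_bigr => i _.
by rewrite mxE mulrCA.
Qed.

(* [nrm] is the norm on layer outputs, [rn] bounds linear forms against it and
   [mn] bounds matrices; [good] is the condition on activations under which a
   whole layer of neurons is controlled by a single neuron. *)
Record layer_norms (R : realType) (nrm rn : forall p, 'cV[R]_p -> R)
    (mn : forall p q, 'M[R]_(p, q) -> R) (good : (R -> R) -> Prop)
    (K0 : nat -> R) : Prop := LayerNorms {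
  nrm_ge0 : forall p (x : 'cV[R]_p), 0 <= nrm p x;
  nrm_le_l2 : forall p (x : 'cV[R]_p), nrm p x <= l2norm x;
  nrm_mono : forall p (x y : 'cV[R]_p) (c : R), 0 <= c ->
    (forall i, `|x i 0| <= c * `|y i 0|) -> nrm p x <= c * nrm p y;
  nrm_dual : forall p (w x : 'cV[R]_p), `|dotp w x| <= rn p w * nrm p x;
  nrm_mulmx : forall p q (A : 'M[R]_(p, q)) x, nrm p (A *m x) <= mn p q A * nrm q x;
  good0 : forall f : R -> R, good f -> f 0 = 0;
  nrm_one_neuron : forall p q (A : 'M[R]_(p, q)) (M : R) (f : R -> R) N
      (b : nat -> R) (x : nat -> 'cV[R]_q), 0 < M -> mn p q A <= M -> good f ->
    exists2 w : 'cV[R]_q, rn q w <= M &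
      nrm p (\sum_(i < N) b i *: map_mx f (A *m x i)) <=
      `|\sum_(i < N) b i * f (dotp w (x i))|;
  nrm_mgf : forall p N (x : nat -> 'cV[R]_p) (l V : R), (0 < p)%N -> 0 <= l ->
    \sum_(i < N) l2norm (x i) ^+ 2 <= V ->
    signE N (fun s => expR (l * nrm p (sign_sum N x s))) <=
    K0 p * expR (l ^+ 2 * V / 2 + l * Num.sqrt V) }.

Section networks.
Context (R : realType) (d : nat) (k : nat -> nat) (sigma : nat -> R -> R)
  (L M : nat -> R).
Context (nrm rn : forall p, 'cV[R]_p -> R)
  (mn : forall p q, 'M[R]_(p, q) -> R) (good : (R -> R) -> Prop)
  (K0 : nat -> R) (norms : layer_norms nrm rn mn good K0).
Hypothesis d_gt0 : (0 < d)%N.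
Hypothesis k1_gt0 : (0 < k 1)%N.
Hypothesis M_gt0 : forall i, (1 <= i <= d)%N -> 0 < M i.
Hypothesis L_gt0 : forall i, (1 <= i < d)%N -> 0 < L i.
Hypothesis sigma_lip : forall i, (1 <= i < d)%N ->
  forall x y, `|sigma i x - sigma i y| <= L i * `|x - y|.
Hypothesis sigma_good : forall i, (1 <= i < d)%N -> good (sigma i).

Definition admissible : set (parameters R d k) :=
  [set p | (forall i, (1 <= i < d)%N -> mn (p.1 i) <= M i) /\ rn p.2 <= M d].

Definition layer_gain (l : nat) : R := \prod_(1 <= i < l.+1) (M i * L i).

Let sigma0 i : (1 <= i < d)%N -> sigma i 0 = 0.
Proof. by move=> /sigma_good/(good0 norms). Qed.

Lemma layer_gainS l : layer_gain l.+1 = layer_gain l * (M l.+1 * L l.+1).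
Proof. by rewrite /layer_gain big_nat_recr. Qed.

Lemma layer_gain_gt0 l : (l < d)%N -> 0 < layer_gain l.
Proof.
move=> ld; rewrite /layer_gain big_nat prodr_gt0// => i /andP[i1 il].
by rewrite mulr_gt0 ?M_gt0 ?L_gt0 ?i1//= ?(leq_trans il)// ltnW// (leq_trans il).
Qed.

Lemma hidden0 (p : parameters R d k) l : (l < d)%N -> hidden sigma p.1 0 l = 0.
Proof.
elim: l => [//|l IH] ld /=; rewrite IH ?(ltnW ld)// mulmx0.
by apply/colP => i; rewrite !mxE sigma0.
Qed.

Lemma hidden_lipschitz (p : parameters R d k) x y l : admissible p -> (l < d)%N ->
  nrm (hidden sigma p.1 x l - hidden sigma p.1 y l) <=
  layer_gain l * nrm (x - y).
Proof.
move=> [pM _]; elim: l => [_|l IH ld].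
  by rewrite /layer_gain big_geq// mul1r.
have ld' : (1 <= l.+1 < d)%N by [].
have L0 := ltW (L_gt0 ld').
apply: (@le_trans _ _ (L l.+1 *
  nrm (p.1 l.+1 *m (hidden sigma p.1 x l - hidden sigma p.1 y l)))).
  apply: (nrm_mono norms) => // i.
  by rewrite mulmxBr !mxE; exact: sigma_lip.
rewrite layer_gainS (_ : _ * _ * _ =
  L l.+1 * (M l.+1 * (layer_gain l * nrm (x - y)))); last by ring.
apply: ler_wpM2l => //; apply: (le_trans (nrm_mulmx norms _ _)).
apply: (@le_trans _ _ (M l.+1 *
    nrm (hidden sigma p.1 x l - hidden sigma p.1 y l))).
  by apply: ler_wpM2r; [exact: nrm_ge0 norms _ _|exact: pM].
apply: ler_wpM2l; last exact: IH (ltnW ld).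
by apply/ltW/M_gt0; rewrite /= ltnW.
Qed.

Definition network_gain : R := M d * layer_gain d.-1.

Lemma network_gain_gt0 : 0 < network_gain.
Proof. by rewrite mulr_gt0 ?layer_gain_gt0 ?prednK// M_gt0 ?leqnn ?andbT. Qed.

Lemma networkE (p : parameters R d k) x :
  network sigma p x = dotp p.2 (hidden sigma p.1 x d.-1).
Proof. by rewrite /network mxE; apply: eq_bigr => j _; rewrite mxE. Qed.

Lemma dotpBr q (w x y : 'cV[R]_q) : dotp w (x - y) = dotp w x - dotp w y.
Proof. by rewrite /dotp -sumrB; apply: eq_bigr => j _; rewrite !mxE mulrBr. Qed.

Lemma dotp_le (p : parameters R d k) x : admissible p ->
  `|dotp p.2 x| <= M d * nrm x.
Proof.
move=> [_ pM]; apply: (le_trans (nrm_dual norms _ _)).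
by apply: ler_wpM2r => //; exact: nrm_ge0 norms _ _.
Qed.

Lemma network_lipschitz (p : parameters R d k) x y : admissible p ->
  `|network sigma p x - network sigma p y| <= network_gain * l2norm (x - y).
Proof.
move=> adp; rewrite !networkE -dotpBr; apply: (le_trans (dotp_le _ adp)).
have Md : 0 < M d by rewrite M_gt0 ?leqnn ?andbT.
rewrite /network_gain -mulrA ler_pM2l//.
apply: (le_trans (hidden_lipschitz _ _ adp _)); first by rewrite prednK.
apply: ler_wpM2l; last exact: nrm_le_l2 norms _ _.
by apply/ltW/layer_gain_gt0; rewrite prednK.
Qed.

Lemma network0 (p : parameters R d k) : network sigma p 0 = 0.
Proof.
rewrite networkE hidden0 ?prednK// /dotp big1// => j _.
by rewrite mxE mulr0.
Qed.

(** Induction on the layers, for every [c]: after the top activation is removed, what remains is a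
    linear form of the layer below, bounded by [M l.+1] times its norm, so the same estimate is
    needed with [c * (L l.+1 * M l.+1)] in place of [c]. The network may depend on the signs, as it
    would if it attained a supremum. *)
Lemma hidden_mgf N (a : nat -> R) (x : nat -> 'cV[R]_(k 1)) (V : R) l
    (p : seq bool -> parameters R d k) (c : R) :
  \sum_(i < N) l2norm (a i *: x i) ^+ 2 <= V ->
  (l < d)%N -> (forall s, admissible (p s)) -> 0 <= c ->
  signE N (fun s => expR (c * nrm (sign_sum N
    (fun i => a i *: hidden sigma (p s).1 (x i) l) s))) <=
  2 ^+ l * K0 (k 1) * expR ((c * layer_gain l) ^+ 2 * V / 2 +
                          c * layer_gain l * Num.sqrt V).
Proof.
move=> aV; elim: l p c => [|l IH] p c ld adp c0.
  rewrite /layer_gain big_geq// mulr1 expr0 mul1r.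
  exact: (@nrm_mgf _ _ _ _ _ _ norms _ N (fun i => a i *: x i) c V k1_gt0 c0 aV).
have ld' : (1 <= l.+1 < d)%N by [].
have L0 := ltW (L_gt0 ld').
have M0 : 0 < M l.+1 by rewrite M_gt0//= ltnW.
set f := sigma l.+1; pose H s i := hidden sigma (p s).1 (x i) l.
have /choice[w wP] s : exists w : 'cV[R]_(k l.+1), rn w <= M l.+1 /\
    nrm (sign_sum N (fun i => a i *: hidden sigma (p s).1 (x i) l.+1) s) <=
    `|\sum_(i < N) (-1) ^+ nth false s i * (a i * f (dotp w (H s i)))|.
  have [pM _] := adp s.
  have [w wM hw] := @nrm_one_neuron _ _ _ _ _ _ norms _ _ ((p s).1 l.+1)
    (M l.+1) f N (fun i => (-1) ^+ nth false s i * a i) (H s) M0 (pM _ ld')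
    (sigma_good ld').
  exists w; split => //; rewrite /sign_sum.
  under eq_bigr do rewrite scalerA.
  by under [in leRHS]eq_bigr do rewrite mulrA.
pose S s := \sum_(i < N) (-1) ^+ nth false s i * (a i * f (dotp (w s) (H s i))).
(* Contraction sees only [|t|], so one argument serves both signs in
   [e^(c|S|) <= e^(cS) + e^(-cS)]. *)
have half (t : R) : `|t| = c ->
    signE N (fun s => expR (t * S s)) <=
    2 ^+ l * K0 (k 1) * expR ((c * layer_gain l.+1) ^+ 2 * V / 2 +
                            c * layer_gain l.+1 * Num.sqrt V).
  move=> tc.
  pose u i s := t * (a i * f (dotp (w s) (H s i))).
  pose v i s := c * (a i * (L l.+1 * dotp (w s) (H s i))).
  have fL y z : `|f y - f z| <= L l.+1 * `|y - z| by exact: sigma_lip.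
  have uvB i s s' : `|u i s - u i s'| <= `|v i s - v i s'|.
    rewrite /u /v -!mulrBr !normrM tc (ger0_norm c0) (ger0_norm L0).
    by rewrite !ler_wpM2l.
  have uv i s : `|u i s| <= `|v i s|.
    rewrite /u /v !normrM tc (ger0_norm c0) (ger0_norm L0) !ler_wpM2l//.
    by have := fL (dotp (w s) (H s i)) 0; rewrite /f sigma0// !subr0.
  (* Network and neuron are both functions of the sign vector, so sign vectors themselves serve as
     parameters, selected at first by [id]. Contraction returns a reselection [r], and [p (r s)] is
     again a choice of networks, to which the induction hypothesis applies. *)
  have [r hr] := @rademacher_contraction R (seq bool) N u v (fun=> 0) id uv uvB.
  have e1 s : t * S s = 0 + \sum_(i < N) (-1) ^+ nth false s i * u i s.
    by rewrite add0r mulr_sumr; apply: eq_bigr => i _; rewrite mulrCA.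
  rewrite (eq_signE (fun s _ => congr1 expR (e1 s))).
  apply: (le_trans hr).
  have := IH (fun s => p (r s)) (c * (L l.+1 * M l.+1)) (ltnW ld)
    (fun s => adp (r s)).
  rewrite layer_gainS (_ : c * (_ * _) * _ =
    c * (layer_gain l * (M l.+1 * L l.+1))); last by ring.
  rewrite mulr_ge0 ?mulr_ge0 ?(ltW M0)// => /(_ isT).
  apply: le_trans; apply: ler_signE => s _; rewrite ler_expR add0r.
  have -> : \sum_(i < N) (-1) ^+ nth false s i * v i (r s) =
    c * (L l.+1 * dotp (w (r s)) (sign_sum N (fun i => a i *: H (r s) i) s)).
    rewrite /sign_sum; under [in RHS]eq_bigr do rewrite scalerA.
    rewrite (dotp_sumr _ _ (fun i => (-1) ^+ nth false s i * a i)) !mulr_sumr.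
    by apply: eq_bigr => i _; rewrite /v; ring.
  rewrite -!mulrA !ler_wpM2l//.
  apply: (le_trans (ler_norm _)); apply: (le_trans (nrm_dual norms _ _)).
  by apply: ler_wpM2r; [exact: nrm_ge0 norms _ _|case: (wP (r s))].
set E := expR _ in half *.
rewrite exprS (_ : 2 * _ * _ * _ = 2 ^+ l * K0 (k 1) * E + 2 ^+ l * K0 (k 1) * E);
  last by ring.
apply: (le_trans _ (lerD (half c (ger0_norm c0)) (half (- c) _))); last first.
  by rewrite normrN ger0_norm.
rewrite -signED; apply: ler_signE => s _.
have [_ h] := wP s.
apply: (@le_trans _ _ (expR (c * `|S s|))); first by rewrite ler_expR ler_wpM2l.
have := expR_gt0 (c * S s); have := expR_gt0 (- c * S s).
have [S0|S0] := leP 0 (S s); first by rewrite ger0_norm//; lra.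
by rewrite ltr0_norm// mulrN -mulNr; lra.
Qed.

(** Duality absorbs the absolute value at the linear output, so only the [d.-1] hidden layers
    contribute a factor 2. *)
Lemma network_mgf N (a : nat -> R) (x : nat -> 'cV[R]_(k 1)) (V : R)
    (p : seq bool -> parameters R d k) (c : R) :
  \sum_(i < N) l2norm (a i *: x i) ^+ 2 <= V ->
  (forall s, admissible (p s)) -> 0 <= c ->
  signE N (fun s => expR (c * `|\sum_(i < N) (-1) ^+ nth false s i *
    (a i * network sigma (p s) (x i))|)) <=
  2 ^+ d.-1 * K0 (k 1) * expR ((c * network_gain) ^+ 2 * V / 2 +
                             c * network_gain * Num.sqrt V).
Proof.
move=> aV adp c0; have Md : 0 < M d by rewrite M_gt0 ?leqnn ?andbT.
have ld : (d.-1 < d)%N by rewrite prednK.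
have := @hidden_mgf N a x V d.-1 p (c * M d) aV ld adp.
rewrite mulr_ge0 ?(ltW Md)// -(mulrA c) -/network_gain.
move=> /(_ isT); apply: le_trans; apply: ler_signE => s _.
rewrite ler_expR -mulrA ler_wpM2l//.
apply: (le_trans _ (dotp_le _ (adp s))); rewrite /sign_sum.
under [in leRHS]eq_bigr do rewrite scalerA.
rewrite (dotp_sumr _ _ (fun i => (-1) ^+ nth false s i * a i)
  (fun i => hidden sigma (p s).1 (x i) d.-1)).
by under eq_bigr do rewrite mulrA networkE.
Qed.

End networks.

(** * The Frobenius and (1, infinity) geometries *)

Definition pos_homogeneous (R : realType) (f : R -> R) : Prop :=
  forall alpha x, 0 < alpha -> f (alpha * x) = alpha * f x.

Definition linfnorm (R : realType) (p : nat) (x : 'cV[R]_p) : R :=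
  \big[Num.max/0]_(i < p) `|x i 0|.

Lemma pos_homogeneous0 (R : realType) (f : R -> R) : pos_homogeneous f -> f 0 = 0.
Proof. by move=> /(_ 2 0); rewrite mulr0 => /(_ ltac:(lra)); lra. Qed.

Lemma frobenius_sqr (R : realType) p q (A : 'M[R]_(p, q)) :
  frobenius A ^+ 2 = \sum_(i < p) l2norm (row i A)^T ^+ 2.
Proof.
rewrite sqr_sqrtr; last by apply: sumr_ge0 => i _; exact: sum_sqr_ge0.
by apply: eq_bigr => i _; rewrite l2norm_sqr; apply: eq_bigr => j _; rewrite !mxE.
Qed.

Lemma mulmx_dotp (R : realType) p q (A : 'M[R]_(p, q)) x i :
  (A *m x) i 0 = dotp (row i A)^T x.
Proof. by rewrite mxE; apply: eq_bigr => j _; rewrite !mxE. Qed.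

Lemma l2norm_mulmx (R : realType) p q (A : 'M[R]_(p, q)) (x : 'cV[R]_q) :
  l2norm (A *m x) <= frobenius A * l2norm x.
Proof.
rewrite -(@ler_pXn2r _ 2)// ?nnegrE ?mulr_ge0 ?l2norm_ge0 ?sqrtr_ge0//.
rewrite exprMn frobenius_sqr l2norm_sqr mulr_suml; apply: ler_sum => i _.
rewrite -exprMn -real_normK ?num_real// ler_pXn2r ?nnegrE ?mulr_ge0 ?l2norm_ge0//.
by rewrite mulmx_dotp; exact: l2norm_dot.
Qed.

Lemma sum_map_mx_coord (R : realType) p q N (A : 'M[R]_(p, q)) (f : R -> R)
    (b : nat -> R) (x : nat -> 'cV[R]_q) j :
  (\sum_(i < N) b i *: map_mx f (A *m x i)) j 0 =
  \sum_(i < N) b i * f (dotp (row j A)^T (x i)).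
Proof.
by rewrite summxE; apply: eq_bigr => i _; rewrite -mulmx_dotp !mxE.
Qed.

(* Writing the j-th row as (|w_j|/M) w'_j with |w'_j| = M, homogeneity pulls the
   factors out; their squares sum to at most 1, so the best w'_j dominates. *)
Lemma l2norm_one_neuron (R : realType) p q (A : 'M[R]_(p, q)) (M : R)
    (f : R -> R) N (b : nat -> R) (x : nat -> 'cV[R]_q) :
  0 < M -> frobenius A <= M -> pos_homogeneous f ->
  exists2 w : 'cV[R]_q, l2norm w <= M &
    l2norm (\sum_(i < N) b i *: map_mx f (A *m x i)) <=
    `|\sum_(i < N) b i * f (dotp w (x i))|.
Proof.
move=> M0 AM hf; have f0 := pos_homogeneous0 hf.
pose r j := l2norm (row j A)^T.
(* For a zero row, division by 0 makes [w j] the zero vector; the identity [w_row] and the bound by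
   [M] still hold. *)
pose w j := (M / r j) *: (row j A)^T.
pose y j := \sum_(i < N) b i * f (dotp (w j) (x i)).
have w_row j : (row j A)^T = (r j / M) *: w j.
  rewrite /w scalerA; have [rj0|rj0] := eqVneq (r j) 0.
    rewrite rj0 !mul0r scale0r; apply/colP => i; rewrite [RHS]mxE.
    apply/eqP; rewrite -normr_le0 -[leRHS]rj0; exact: coord_le_l2norm.
  by rewrite mulrA divfK ?gt_eqF// divff// scale1r.
have wM j : l2norm (w j) <= M.
  rewrite l2normZ ger0_norm ?divr_ge0 ?l2norm_ge0 ?(ltW M0)// -/(r j).
  have [->|rj0] := eqVneq (r j) 0; first by rewrite mulr0 ltW.
  by rewrite divfK.
have coordE j : (\sum_(i < N) b i *: map_mx f (A *m x i)) j 0 = r j / M * y j.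
  rewrite sum_map_mx_coord mulr_sumr; apply: eq_bigr => i _; rewrite mulrCA.
  congr (_ * _); rewrite w_row.
  have -> : dotp ((r j / M) *: w j) (x i) = r j / M * dotp (w j) (x i).
    by rewrite /dotp mulr_sumr; apply: eq_bigr => l _; rewrite mxE mulrA.
  have [rj0|rj0] := eqVneq (r j) 0; first by rewrite rj0 !mul0r f0.
  by rewrite hf// divr_gt0// lt_neqAle eq_sym rj0 l2norm_ge0.
have [j0 _|p0] := pickP (@predT 'I_p); last first.
  exists 0; first by rewrite l2norm0 ltW.
  by rewrite /l2norm big_pred0//= sqrtr0.
have [j _ jmax] := Order.TotalTheory.arg_maxP (fun j => `|y j|) (isT : predT j0).
have {}jmax i : `|y i| <= `|y j| := jmax i isT.
exists (w j) => //; rewrite -/(y j).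
rewrite -(@ler_pXn2r _ 2)// ?nnegrE ?l2norm_ge0// l2norm_sqr.
apply: (@le_trans _ _ (\sum_i (r i / M) ^+ 2 * `|y j| ^+ 2)).
  apply: ler_sum => i _; rewrite coordE exprMn ler_wpM2l ?sqr_ge0//.
  by rewrite -[leLHS]real_normK ?num_real// ler_pXn2r ?nnegrE// jmax.
rewrite -mulr_suml ler_piMl ?sqr_ge0//.
under eq_bigr do rewrite expr_div_n.
rewrite -mulr_suml -frobenius_sqr ler_pdivrMr ?exprn_gt0// mul1r.
by rewrite ler_pXn2r ?nnegrE ?sqrtr_ge0// ltW.
Qed.

Lemma l2_layer_norms (R : realType) :
  layer_norms (@l2norm R) (@l2norm R) (@frobenius R) (@pos_homogeneous R)
    (fun=> 1).
Proof.
split.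
- by move=> p x; exact: l2norm_ge0.
- by [].
- move=> p x y c c0 xy.
  rewrite -(@ler_pXn2r _ 2)// ?nnegrE ?mulr_ge0 ?l2norm_ge0//.
  rewrite exprMn !l2norm_sqr mulr_sumr; apply: ler_sum => i _.
  rewrite -[leLHS]real_normK ?num_real// -[X in _ * X]real_normK ?num_real//.
  by rewrite -exprMn ler_pXn2r ?nnegrE ?mulr_ge0.
- by move=> p w x; exact: l2norm_dot.
- by move=> p q A x; exact: l2norm_mulmx.
- by move=> f; exact: pos_homogeneous0.
- by move=> p q A M f N b x; exact: l2norm_one_neuron.
- by move=> p N x l V _ l0 xV; rewrite mul1r signE_exp_l2norm_le.
Qed.

Section linfnorm_theory.
Context (R : realType).

Lemma linfnorm_ge0 p (x : 'cV[R]_p) : 0 <= linfnorm x.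
Proof. exact: bigmax_ge_id. Qed.

Lemma coord_le_linfnorm p (x : 'cV[R]_p) i : `|x i 0| <= linfnorm x.
Proof. exact: le_bigmax. Qed.

Lemma linfnorm_le p (x : 'cV[R]_p) (c : R) : 0 <= c ->
  (forall i, `|x i 0| <= c) -> linfnorm x <= c.
Proof. by move=> c0 xc; apply: bigmax_le. Qed.

Lemma linfnorm_attained p (x : 'cV[R]_p) : (0 < p)%N ->
  exists i, linfnorm x = `|x i 0|.
Proof.
case: p x => // p x _; rewrite /linfnorm.
by rewrite (bigmax_eq_arg _ ord0)//; eexists.
Qed.

Lemma l1norm_dual p (w x : 'cV[R]_p) :
  `|dotp w x| <= l1norm w * linfnorm x.
Proof.
apply: (le_trans (ler_norm_sum _ _ _)); rewrite mulr_suml.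
by apply: ler_sum => i _; rewrite normrM ler_wpM2l// coord_le_linfnorm.
Qed.

Lemma row_l1norm_le p q (A : 'M[R]_(p, q)) i : l1norm (row i A)^T <= norm1oo A.
Proof.
rewrite (_ : l1norm _ = \sum_(j < q) `|A i j|); first exact: le_bigmax.
by apply: eq_bigr => j _; rewrite !mxE.
Qed.

(** The sup norm is attained at one coordinate, whose row is the single neuron; no homogeneity is
    called for. In the exponential moment the maximum over [p] coordinates is bounded by a sum of
    [p] exponentials, whence the constant [p]. *)
Lemma linf_layer_norms :
  layer_norms (@linfnorm R) (@l1norm R) (@norm1oo R) (fun f : R -> R => f 0 = 0)
    (fun p => p%:R).
Proof.
split.
- exact: linfnorm_ge0.
- by move=> p x; apply: linfnorm_le => [|i]; [exact: l2norm_ge0|exact: coord_le_l2norm].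
- move=> p x y c c0 xy; apply: linfnorm_le => [|i].
    by rewrite mulr_ge0// linfnorm_ge0.
  by apply: (le_trans (xy i)); rewrite ler_wpM2l// coord_le_linfnorm.
- exact: l1norm_dual.
- move=> p q A x; apply: linfnorm_le => [|i].
    by rewrite mulr_ge0 ?linfnorm_ge0//; exact: bigmax_ge_id.
  rewrite mulmx_dotp; apply: (le_trans (l1norm_dual _ _)).
  by rewrite ler_wpM2r ?linfnorm_ge0// row_l1norm_le.
- by [].
- move=> p q A M f N b x M0 AM f0.
  have [p_0|p0] := posnP p.
    exists 0; first by rewrite /l1norm big1 ?ltW// => j _; rewrite mxE normr0.
    apply: linfnorm_le => // i.
    by have p1 := leq_ltn_trans (leq0n i) (ltn_ord i); rewrite p_0 in p1.
  have [j ->] := linfnorm_attained (\sum_(i < N) b i *: map_mx f (A *m x i)) p0.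
  exists (row j A)^T; first exact: le_trans (row_l1norm_le _ _) AM.
  by rewrite sum_map_mx_coord.
- move=> p N x l V p0 l0 xV.
  (* Each coordinate is viewed as a vector of dimension 1, so that the Euclidean estimate covers
     scalar Rademacher sums. *)
  pose y j i : 'cV[R]_1 := const_mx (x i j 0).
  apply: (@le_trans _ _ (\sum_(j < p)
      signE N (fun s => expR (l * l2norm (sign_sum N (y j) s))))); last first.
    rewrite -[X in X%:R * _](card_ord p) mulr_natl -sumr_const.
    apply: ler_sum => j _; apply: signE_exp_l2norm_le => //.
    apply: le_trans xV; apply: ler_sum => i _.
    rewrite ler_pXn2r ?nnegrE ?l2norm_ge0//.
    by rewrite {1}/l2norm big_ord1 mxE sqrtr_sqr coord_le_l2norm.
  rewrite /signE -prodE_sum; apply: ler_signE => s _.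
  have [j ->] := linfnorm_attained (sign_sum N x s) p0.
  rewrite (bigD1 j)//=; apply: (@le_trans _ _ (expR (l * l2norm (sign_sum N (y j) s)))).
    rewrite ler_expR ler_wpM2l//; apply: le_trans (coord_le_l2norm _ 0).
    rewrite /sign_sum !summxE le_eqVlt; apply/orP; left; apply/eqP; congr `|_|.
    by apply: eq_bigr => i _; rewrite !mxE.
  by rewrite lerDl; apply: sumr_ge0 => i _; exact: expR_ge0.
Qed.

End linfnorm_theory.

(** * Uniform deviations on a finite space *)

Section prodE_product.
Context (R : realType).

Lemma prodE_exchange (C C' : finType) (p : nat -> C -> R) (p' : nat -> C' -> R)
    N N' (G : seq C -> seq C' -> R) :
  prodE p N (fun s => prodE p' N' (G s)) =
  prodE p' N' (fun s' => prodE p N (fun s => G s s')).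
Proof.
elim: N p G => [//|N IH] p G /=.
rewrite (@eq_prodE _ _ p' N' _ (fun s' => \sum_c p 0%N c *
  prodE (fun i => p i.+1) N (fun s => G (c :: s) s'))) // prodE_sum.
by apply: eq_bigr => c _; rewrite prodEZ -IH.
Qed.

Definition pair_pmf (C : finType) (p : nat -> C -> R) (i : nat) (c : C * C) : R :=
  p i c.1 * p i c.2.

Lemma pmf_pair (C : finType) (p : nat -> C -> R) i :
  pmf (p i) -> pmf (pair_pmf p i).
Proof.
move=> [p0 p1]; split=> [c|]; first by rewrite mulr_ge0.
rewrite -(pair_bigA _ (fun a b => p i a * p i b))/=.
by under eq_bigr do rewrite -mulr_sumr p1 mulr1.
Qed.

Lemma prodE_pair (C : finType) (p : nat -> C -> R) N (G : seq C -> seq C -> R) :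
  prodE p N (fun s => prodE p N (G s)) =
  prodE (pair_pmf p) N (fun ss => G (unzip1 ss) (unzip2 ss)).
Proof.
elim: N p G => [//|N IH] p G.
transitivity (\sum_a \sum_b p 0%N a * p 0%N b *
   prodE (fun i => pair_pmf p i.+1) N
     (fun ss => G (a :: unzip1 ss) (b :: unzip2 ss))); last first.
  by rewrite (pair_bigA _ (fun a b => p 0%N a * p 0%N b *
   prodE (fun i => pair_pmf p i.+1) N
     (fun ss => G (a :: unzip1 ss) (b :: unzip2 ss)))).
rewrite /=; apply: eq_bigr => a _; rewrite prodE_sum mulr_sumr.
apply: eq_bigr => b _.
by rewrite prodEZ mulrA (IH (fun i => p i.+1) (fun s s' => G (a :: s) (b :: s'))).
Qed.

Lemma prodE_sum_coord (C : finType) (c0 : C) (p : nat -> C -> R) N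
    (F : nat -> C -> R) : (forall i, pmf (p i)) ->
  prodE p N (fun s => \sum_(i < N) F i (nth c0 s i)) =
  \sum_(i < N) \sum_c p i c * F i c.
Proof.
elim: N p F => [|N IH] p F pp; first by rewrite /= !big_ord0.
rewrite big_ord_recl /=.
rewrite (eq_bigr (fun c => p 0%N c * F 0%N c + p 0%N c *
    \sum_(i < N) \sum_c p i.+1 c * F i.+1 c)) => [|c _].
  by rewrite big_split/= -mulr_suml; case: (pp 0%N) => _ ->; rewrite mul1r.
rewrite -mulrDr -(IH (fun i => p i.+1) (fun i => F i.+1))//.
congr (_ * _); rewrite -[F 0%N c in RHS](@prodE_cst R C (fun i => p i.+1) N)//.
by rewrite -prodED; apply: eq_prodE => s _; rewrite big_ord_recl.
Qed.

Definition swap_pairs (C : Type) (e : seq bool) (ss : seq (C * C)) :=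
  [seq if x.1 then (x.2.2, x.2.1) else x.2 | x <- zip e ss].

(** Each [pair_pmf p i] is symmetric, so exchanging any set of pairs preserves the law; this is how
    signs enter the symmetrization. *)
Lemma prodE_swap (C : finType) (p : nat -> C -> R) N (e : seq bool)
    (G : seq (C * C) -> R) : size e = N ->
  prodE (pair_pmf p) N (fun ss => G (swap_pairs e ss)) = prodE (pair_pmf p) N G.
Proof.
elim: N p e G => [|N IH] p [|b e] G //= [eN].
transitivity (\sum_(c : C * C) pair_pmf p 0 c * prodE (fun i => pair_pmf p i.+1) N
    (fun ss => G ((if b then (c.2, c.1) else c) :: ss))).
  apply: eq_bigr => c _; congr (_ * _).
  exact: (IH (fun i => p i.+1) e
    (fun ss => G ((if b then (c.2, c.1) else c) :: ss)) eN).
case: b => //.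
rewrite [RHS](reindex_inj (h := fun c : C * C => (c.2, c.1))) /=; last first.
  by move=> [a b] [a' b'] [-> ->].
by apply: eq_bigr => c _; congr (_ * _); rewrite /pair_pmf/= mulrC.
Qed.

End prodE_product.

Section uniform_deviation.
Context (R : realType) (C : finType) (c0 : C) (T : Type) (t0 : T) (N : nat).
Context (p : nat -> C -> R) (a : nat -> R) (f : T -> C -> R) (M : R).
Hypothesis pmf_p : forall i, pmf (p i).
Hypothesis M_gt0 : 0 < M.
Hypothesis f_le : forall t c, `|f t c| <= M.

Let mean i t := \sum_c p i c * f t c.
Let V := \sum_(i < N) a i ^+ 2.
Hypothesis V_gt0 : 0 < V.

Definition deviation (t : T) (s : seq C) : R :=
  \sum_(i < N) a i * (mean i t - f t (nth c0 s i)).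

Definition sup_deviation (s : seq C) : R :=
  sup (range (fun t => `|deviation t s|)).

Lemma mean_le i t : `|mean i t| <= M.
Proof.
apply: (le_trans (ler_norm_sum _ _ _)).
case: (pmf_p i) => p0 p1; rewrite -[M]mul1r -p1 mulr_suml.
by apply: ler_sum => c _; rewrite normrM (ger0_norm (p0 c)) ler_wpM2l.
Qed.

Lemma deviation_le t s : `|deviation t s| <= \sum_(i < N) `|a i| * (2 * M).
Proof.
apply: (le_trans (ler_norm_sum _ _ _)); apply: ler_sum => i _.
rewrite normrM ler_wpM2l//; apply: (le_trans (ler_normB _ _)).
by rewrite mulr_natl mulr2n lerD// mean_le.
Qed.

Lemma has_sup_deviation s : has_sup (range (fun t => `|deviation t s|)).
Proof.
split; first by exists (`|deviation t0 s|), t0.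
by exists (\sum_(i < N) `|a i| * (2 * M)) => _ [t _ <-]; exact: deviation_le.
Qed.

Lemma deviation_le_sup t s : `|deviation t s| <= sup_deviation s.
Proof. by apply: ub_le_sup; [case: (has_sup_deviation s)|exists t]. Qed.

Lemma sup_deviation_bounded_difference s1 s2 b c :
  (size s1 + size s2).+1 = N ->
  sup_deviation (s1 ++ b :: s2) - sup_deviation (s1 ++ c :: s2) <=
  2 * M * `|a (size s1)|.
Proof.
move=> sN; rewrite lerBlDl; apply: ge_sup.
  by case: (has_sup_deviation (s1 ++ b :: s2)).
move=> _ [t _ <-]; apply: (le_trans _ (lerD (deviation_le_sup t _) (lexx _))).
rewrite -lerBlDl; apply: (le_trans (lerB_dist _ _)).
have s1N : (size s1 < N)%N by rewrite -sN ltnS leq_addr.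
rewrite /deviation -sumrB (bigD1 (Ordinal s1N))//= big1 => [|i].
  rewrite addr0 !nth_cat ltnn subnn/= -mulrBr normrM mulrC ler_wpM2r//.
  have := f_le t b; have := f_le t c; rewrite !ler_norml; lra.
move=> /negP in1; rewrite !nth_cat; have [lt|ge] := ltnP i (size s1).
  by rewrite subrr.
have : (0 < i - size s1)%N.
  rewrite subn_gt0 ltn_neqAle ge andbT; apply/negP => /eqP eq.
  by apply: in1; apply/eqP/val_inj.
by case: (i - size s1)%N => // k _; rewrite subrr.
Qed.

(** Jensen's inequality replaces the means by an independent ghost sample; exchanging the i-th pair
    flips the sign of the i-th term. The triangle inequality separates sample and ghost sample, each
    contributing [B]. *)
Lemma symmetrization (tau : seq C -> T) (B : R) :
  (forall (x : nat -> C) (t : seq bool -> T),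
    signE N (fun e => `|\sum_(i < N) (-1) ^+ nth false e i *
                          (a i * f (t e) (x i))|) <= B) ->
  prodE p N (fun s => `|deviation (tau s) s|) <= 2 * B.
Proof.
move=> radB.
pose H (t : T) (ss : seq (C * C)) := \sum_(i < N)
  a i * (f t (nth (c0, c0) ss i).2 - f t (nth (c0, c0) ss i).1).
have pmf2 i : pmf (pair_pmf p i) by exact: pmf_pair.
have normE q (g : seq C -> R) : (forall i, pmf (q i)) ->
    `|prodE q N g| <= prodE q N (fun s => `|g s|).
  move=> qq; rewrite ler_norml lerNl -mulN1r -prodEZ.
  by rewrite !ler_prodE// => s _; rewrite ?mulN1r ?ler_norm// -normrN ler_norm.
apply: (@le_trans _ _ (prodE (pair_pmf p) N (fun ss => `|H (tau (unzip1 ss)) ss|))).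
  pose G s s' := `|\sum_(i < N) a i * (f (tau s) (nth c0 s' i) - f (tau s) (nth c0 s i))|.
  apply: (@le_trans _ _ (prodE p N (fun s => prodE p N (G s)))).
    apply: ler_prodE => // s _.
    apply: le_trans (normE p _ pmf_p); rewrite /deviation.
    rewrite (@prodE_sum_coord _ _ c0 p N
      (fun i c => a i * (f (tau s) c - f (tau s) (nth c0 s i))))//.
    rewrite le_eqVlt; apply/orP; left; apply/eqP; congr `|_|.
    apply: eq_bigr => i _; rewrite /mean.
    transitivity (\sum_c (a i * (p i c * f (tau s) c) -
       p i c * (a i * f (tau s) (nth c0 s i)))).
      rewrite sumrB -mulr_sumr -mulr_suml; case: (pmf_p i) => _ ->.
      by rewrite mul1r mulrBr.
    by apply: eq_bigr => c _; ring.
  rewrite prodE_pair le_eqVlt; apply/orP; left; apply/eqP.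
  apply: eq_prodE => ss ssN; rewrite /G /H; congr `|_|; apply: eq_bigr => i _.
  by rewrite /unzip1 /unzip2 !(nth_map (c0, c0)) ?ssN.
set E := prodE _ _ _.
have -> : E = signE N (fun=> E) by rewrite /signE prodE_cst// => i; exact: pmf_sign.
(* After the exchange the selected parameter depends on the signs, which is why the hypothesis on
   [B] quantifies over functions of sign vectors. *)
pose t e ss := tau (unzip1 (swap_pairs e ss)).
have -> : signE N (fun=> E) = signE N (fun e => prodE (pair_pmf p) N (fun ss =>
    `|\sum_(i < N) (-1) ^+ nth false e i * (a i *
       (f (t e ss) (nth (c0, c0) ss i).2 - f (t e ss) (nth (c0, c0) ss i).1))|)).
  apply: eq_signE => e eN; rewrite /E -(prodE_swap p _ eN).
  apply: eq_prodE => ss ssN; congr `|_|; apply: eq_bigr => i _.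
  rewrite /swap_pairs (nth_map (false, (c0, c0))) ?size_zip ?eN ?ssN ?minnn//.
  rewrite nth_zip ?eN ?ssN//=.
  by case: (nth false e i) => /=; rewrite ?expr1 ?expr0 ?mul1r ?mulN1r// -mulrN opprB.
rewrite /signE prodE_exchange -(prodE_cst N (2 * B) pmf2).
apply: ler_prodE => // ss _.
rewrite mulr_natl mulr2n.
apply: le_trans (lerD (radB (fun i => (nth (c0, c0) ss i).2) (t^~ ss))
  (radB (fun i => (nth (c0, c0) ss i).1) (t^~ ss))).
rewrite -signED; apply: ler_signE => e _.
apply: le_trans (ler_normB _ _); rewrite -sumrB le_eqVlt; apply/orP; left.
by apply/eqP; congr `|_|; apply: eq_bigr => i _; rewrite !mulrBr.
Qed.

Context (K delta : R).
Hypothesis K_gt1 : 1 < K.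
Hypothesis delta01 : 0 < delta < 1.
Hypothesis mgf : forall (x : nat -> C) (t : seq bool -> T) (c : R), 0 <= c ->
  signE N (fun e => expR (c * `|\sum_(i < N) (-1) ^+ nth false e i *
                                  (a i * f (t e) (x i))|)) <=
  K * expR ((c * M) ^+ 2 * V / 2 + c * M * Num.sqrt V).

Let w := M * Num.sqrt V.
Let w_gt0 : 0 < w. Proof. by rewrite mulr_gt0// sqrtr_gt0. Qed.

Lemma rademacher_average_le (x : nat -> C) (t : seq bool -> T) :
  signE N (fun e => `|\sum_(i < N) (-1) ^+ nth false e i * (a i * f (t e) (x i))|)
  <= w * (Num.sqrt (2 * ln K) + 1).
Proof.
set E := signE _ _; set l := Num.sqrt (2 * ln K).
have lnK0 : 0 < 2 * ln K by rewrite mulr_gt0// ln_gt0.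
have l0 : 0 < l by rewrite sqrtr_gt0.
have l2 : l ^+ 2 = 2 * ln K by rewrite sqr_sqrtr// ltW.
have w2 : M ^+ 2 * V = w ^+ 2 by rewrite exprMn sqr_sqrtr// ltW.
(* Minimizes [ln K / c + c * w^2 / 2], with minimum [w * sqrt (2 ln K)]; [1 < K] makes it
   positive. *)
pose c := l / w.
have cp : 0 < c by rewrite divr_gt0.
have : expR (c * E) <= expR (ln K + (c ^+ 2 * w ^+ 2 / 2 + c * w)).
  rewrite expRD lnK ?posrE ?(lt_trans _ K_gt1)//.
  have -> : c ^+ 2 * w ^+ 2 / 2 + c * w = (c * M) ^+ 2 * V / 2 + c * M * Num.sqrt V.
    by rewrite -w2 /w; ring.
  apply: le_trans (mgf x t (ltW cp)); rewrite /E -signEZ.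
  by apply: prodE_jensen_exp => i; exact: pmf_sign.
have cw : c * w = l by rewrite /c divfK// gt_eqF.
rewrite ler_expR -exprMn cw l2 => h.
rewrite -(ler_pM2l cp); apply: (le_trans h).
by rewrite mulrA cw mulrDr mulr1 -expr2 l2; lra.
Qed.

Lemma prodE_sup_deviation_le :
  prodE p N sup_deviation <= 2 * (w * (Num.sqrt (2 * ln K) + 1)).
Proof.
apply/ler_addgt0Pr => eta eta0.
(* The supremum may not be attained, so [tau] selects near-maximizers and [eta] is arbitrary. *)
have /choice[tau tauP] s : exists t, sup_deviation s - eta <= `|deviation t s|.
  have [_ [t _ <-] lt] := sup_adherent eta0 (has_sup_deviation s).
  by exists t; exact: ltW.
apply: (@le_trans _ _ (prodE p N (fun s => `|deviation (tau s) s| + eta))).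
  by apply: ler_prodE => // s _; rewrite -lerBlDr.
by rewrite prodED prodE_cst// lerD2r symmetrization//; exact: rademacher_average_le.
Qed.

Lemma sup_deviation_tail :
  prodE p N (fun s => (w * (2 * (Num.sqrt (2 * ln K) + 1) +
    Num.sqrt (2 * ln (1 / delta))) < sup_deviation s)%R%:R) <= delta.
Proof.
case/andP: delta01 => d0 d1.
set r := Num.sqrt (2 * ln (1 / delta)).
have ln0 : 0 < 2 * ln (1 / delta) by rewrite mulr_gt0// ln_gt0// ltr_pdivlMr// mul1r.
have r0 : 0 < r by rewrite sqrtr_gt0.
have r2 : r ^+ 2 = 2 * ln (1 / delta) by rewrite sqr_sqrtr// ltW.
(* The Chernoff optimum: it minimizes [- l w r + l^2 w^2 / 2], giving
   [- r^2 / 2 = - ln (1 / delta)]. *)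
pose l := r / w; have l0 : 0 < l by rewrite divr_gt0.
have lw : l * w = r by rewrite /l divfK// gt_eqF.
set m := prodE p N sup_deviation.
have mB := prodE_sup_deviation_le; rewrite -/m in mB.
apply: (@le_trans _ _ (prodE p N (fun s => expR (- (l * (w * r))) *
    expR (l * (sup_deviation s - m))))).
  apply: ler_prodE => // s _; rewrite -expRD.
  case: ltP => [lt|_]; last exact: expR_ge0.
  rewrite -[leLHS](@expR0 R) ler_expR -mulrN -mulrDr mulr_ge0 ?(ltW l0)//.
  move: lt; rewrite -/r; lra.
rewrite prodEZ.
have := @mcdiarmid_mgf R C p N (fun i => 2 * M * `|a i|) sup_deviation l pmf_p
  (ltW l0) sup_deviation_bounded_difference.
rewrite -(ler_pM2l (expR_gt0 (- (l * (w * r))))) -/m => h; apply: (le_trans h).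
rewrite -expRD (_ : \sum_(i < N) _ = 4 * w ^+ 2); last first.
  rewrite exprMn (sqr_sqrtr (ltW V_gt0)) /V !mulr_sumr.
  by apply: eq_bigr => i _; rewrite !exprMn real_normK ?num_real//; ring.
have -> : - (l * (w * r)) + l ^+ 2 * (4 * w ^+ 2) / 8 = - ln (1 / delta).
  have -> : l ^+ 2 * (4 * w ^+ 2) / 8 = (l * w) ^+ 2 / 2 by field.
  by rewrite mulrA lw -expr2 r2; field.
by rewrite expRN lnK ?posrE ?divr_gt0// div1r invrK.
Qed.

End uniform_deviation.

(** * Discretization and measurability *)

Section borel_cV_theory.
Context (R : realType) (h : nat).
Local Notation T := (borel_cV R h).

Lemma measurable_coord_le (i : 'I_h) (q : R) :
  measurable [set x : T | (x : 'cV[R]_h) i 0 <= q].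
Proof.
rewrite -[X in measurable X]setCK; apply: measurableC.
apply: sub_sigma_algebra; rewrite openC.
have -> : [set x : 'cV[R]_h | x i 0 <= q] =
    (fun x : 'cV[R]_h => x i 0) @^-1` [set y | y <= q] by [].
by apply: closed_comp => [x _|]; [exact: coord_continuous|exact: closed_le].
Qed.

Lemma l2norm_le_coord (x : 'cV[R]_h) (c : R) : 0 <= c ->
  (forall i, `|x i 0| <= c) -> l2norm x <= h%:R * c.
Proof.
move=> c0 xc; rewrite -(@ler_pXn2r _ 2)// ?nnegrE ?l2norm_ge0 ?mulr_ge0//.
rewrite l2norm_sqr; apply: (@le_trans _ _ (\sum_(i < h) c ^+ 2)).
  by apply: ler_sum => i _; rewrite -[leLHS]real_normK ?num_real// ler_pXn2r ?nnegrE.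
rewrite sumr_const card_ord -[leLHS]mulr_natl exprMn ler_wpM2r ?sqr_ge0//.
by rewrite -natrX ler_nat; case: (h) => // n; rewrite expnS leq_pmulr// expn1.
Qed.

(** The first threshold strictly above [a] is at most [a + e]; if [b] were larger than that, this
    threshold would separate them, and its index would be below [J] because [b <= G]. *)
Lemma grid_separation (G e a b : R) (J : nat) : 0 < e -> 2 * G / e < J%:R ->
  `|a| <= G -> `|b| <= G ->
  (forall j : 'I_J, (a <= - G + j%:R * e) = (b <= - G + j%:R * e)) -> b - a <= e.
Proof.
move=> e0 GJ; rewrite !ler_norml => /andP[a1 a2] /andP[b1 b2] sep.
rewrite leNgt; apply/negP => ab.
pose j := (Num.truncn ((a + G) / e)).+1.
have aG : 0 <= (a + G) / e by rewrite divr_ge0 ?(ltW e0)//; lra.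
have /andP[j1 j2] := truncn_itv aG.
have aj : a + G < j%:R * e by rewrite -ltr_pdivrMr.
have ja : j%:R * e <= a + G + e.
  by rewrite /j -natr1 mulrDl mul1r lerD2r -ler_pdivlMr.
have jJ : (j < J)%N.
  by rewrite -(@ltr_nat R) (le_lt_trans _ GJ)// ler_pdivlMr//; lra.
have := sep (Ordinal jJ); rewrite /=.
have -> : a <= - G + j%:R * e by lra.
by move=> /esym; apply/negP; rewrite -ltNge; lra.
Qed.

(* Cells are the sign patterns of finitely many coordinate thresholds, and each
   cell meeting the ball is represented by one of its points in the ball. *)
Lemma finite_discretization (G eps : R) : 0 <= G -> 0 < eps ->
  exists (C : finType) (e : T -> C) (rep : C -> T),
    [/\ forall c, measurable (e @^-1` [set c]),
        forall c, l2norm (rep c : 'cV[R]_h) <= G &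
        forall x : T, l2norm (x : 'cV[R]_h) <= G ->
          l2norm ((rep (e x) : 'cV[R]_h) - x) <= eps].
Proof.
move=> G0 eps0.
(* Coordinates within [w] give Euclidean distance at most [h * w <= eps]; the successor keeps the
   denominator nonzero when [h] is 0. *)
pose w := eps / h.+1%:R; have w0 : 0 < w by rewrite divr_gt0.
pose J := (Num.truncn (2 * G / w)).+1.
have GJ : 2 * G / w < J%:R by exact: truncnS_gt.
pose C := {ffun 'I_h * 'I_J -> bool}.
pose e (x : T) : C := [ffun ij : 'I_h * 'I_J =>
  (x : 'cV[R]_h) ij.1 0 <= - G + ij.2%:R * w].
have /choice[rep repP] (c : C) : exists y : T, l2norm (y : 'cV[R]_h) <= G /\
    ((exists x : T, l2norm (x : 'cV[R]_h) <= G /\ e x = c) -> e y = c).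
  have [[x [xG xc]]|nx] := pselect (exists x : T, l2norm (x : 'cV[R]_h) <= G /\ e x = c).
    by exists x.
  by exists (0 : 'cV[R]_h); split => //; rewrite l2norm0.
exists C, e, rep; split => [c|c|x xG].
- have -> : e @^-1` [set c] = \bigcap_(ij in [set: 'I_h * 'I_J])
      [set x : T | ((x : 'cV[R]_h) ij.1 0 <= - G + ij.2%:R * w) = c ij].
    apply/seteqP; split => [x /= <- ij _ /=|x /= xc]; first by rewrite ffunE.
    by apply/ffunP => ij; rewrite ffunE; exact: (xc ij I).
  apply: fin_bigcap_measurable => // ij _.
  case: (c ij); first exact: measurable_coord_le.
  rewrite (_ : [set _ | _] = ~` [set x : T | (x : 'cV[R]_h) ij.1 0 <= - G + ij.2%:R * w]).
    by apply: measurableC; exact: measurable_coord_le.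
  by apply/seteqP; split => x /=; [move=> /negbT/negP|move=> /negP/negbTE].
- by case: (repP c).
have [yG /(_ (ex_intro _ x (conj xG erefl))) eyx] := repP (e x).
have coordG (z : 'cV[R]_h) i : l2norm z <= G -> `|z i 0| <= G.
  exact/le_trans/coord_le_l2norm.
have sep i j : ((x : 'cV[R]_h) i 0 <= - G + (j : 'I_J)%:R * w) =
               ((rep (e x) : 'cV[R]_h) i 0 <= - G + j%:R * w).
  by have /ffunP/(_ (i, j)) := eyx; rewrite !ffunE.
apply: (@le_trans _ _ (h%:R * w)).
  apply: l2norm_le_coord => [|i]; first exact: ltW.
  rewrite !mxE ler_norml lerNl opprB.
  rewrite (grid_separation w0 GJ (coordG _ i yG) (coordG _ i xG))//.
  by rewrite (grid_separation w0 GJ (coordG _ i xG) (coordG _ i yG)).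
rewrite /w mulrA ler_pdivrMr// mulrC ler_pM2l// ler_nat; exact: leqnSn.
Qed.

Lemma measurable_finite_valued d (Omega : measurableType d) (F : finType)
    (phi : Omega -> F) d' (T' : measurableType d') (g : F -> T') :
  (forall c, measurable (phi @^-1` [set c])) ->
  measurable_fun setT (g \o phi).
Proof.
move=> mphi _ Y mY; rewrite setTI.
rewrite (_ : _ @^-1` _ = \bigcup_(c in [set c | Y (g c)]) phi @^-1` [set c]).
  by apply: fin_bigcup_measurable => // c _; exact: mphi.
by apply/seteqP; split => [x Yx|x [c Yc /= xc]]; [exists (phi x)|rewrite xc].
Qed.

Lemma measurable_cells d (Omega : measurableType d) N (Z : 'I_N -> Omega -> T)
    (C : finType) (e : T -> C) : (forall i, measurable_fun setT (Z i)) ->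
  (forall c, measurable (e @^-1` [set c])) ->
  forall t : N.-tuple C,
  measurable ((fun w => [tuple e (Z i w) | i < N]) @^-1` [set t]).
Proof.
move=> mZ me t; rewrite (_ : _ @^-1` _ =
    \bigcap_(i in [set: 'I_N]) (Z i @^-1` (e @^-1` [set tnth t i]))).
  apply: fin_bigcap_measurable => // i _.
  by rewrite -[X in measurable X]setTI; exact: mZ.
apply/seteqP; split => [w /= <- i _ /=|w /= wt]; first by rewrite tnth_mktuple.
by apply: eq_from_tnth => i; rewrite tnth_mktuple; exact: (wt i I).
Qed.

(** Pointwise limit of functions of finitely many cells, with radius [n] and mesh [1 / (n + 1)]:
    every outcome eventually falls in the ball. Only each [Z i] has to be measurable, so no product
    sigma-algebra appears. *)
Lemma measurable_lipschitz d (Omega : measurableType d) N (Z : 'I_N -> Omega -> T)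
    (g : ('I_N -> 'cV[R]_h) -> R) (K : R) :
  (forall i, measurable_fun setT (Z i)) ->
  (forall z z', `|g z - g z'| <= K * \sum_i l2norm (z i - z' i)) ->
  measurable_fun setT (fun w => g (fun i => Z i w)).
Proof.
move=> mZ gK.
have n1 n : 0 < n.+1%:R^-1 :> R by rewrite invr_gt0.
have disc n := @finite_discretization n%:R n.+1%:R^-1 (ler0n _ _) (n1 n).
have /choice[hn hnP] (n : nat) : exists hn : Omega -> R, measurable_fun setT hn /\
    forall w, (forall i, l2norm (Z i w : 'cV[R]_h) <= n%:R) ->
      `|hn w - g (fun i => Z i w)| <= `|K| * (N%:R * n.+1%:R^-1).
  have [C [e [rep [me _ repe]]]] := disc n.
  exists (fun w => g (fun i => rep (e (Z i w)))); split.
    have := @measurable_finite_valued _ _ _ (fun w => [tuple e (Z i w) | i < N]) _ R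
      (fun t : N.-tuple C => g (fun i => rep (tnth t i))) (measurable_cells mZ me).
    congr (measurable_fun _ _); apply/funext => w /=; congr g.
    by apply/funext => i; rewrite tnth_mktuple.
  move=> w Zn; apply: (le_trans (gK _ _)).
  apply: (@le_trans _ _ (`|K| *
      \sum_(i < N) l2norm ((rep (e (Z i w)) : 'cV[R]_h) - Z i w))).
    by rewrite ler_wpM2r ?ler_norm//; apply: sumr_ge0 => i _; exact: l2norm_ge0.
  rewrite ler_wpM2l// -[N in N%:R]card_ord mulr_natl -sumr_const.
  by apply: ler_sum => i _; exact: repe.
apply: (@measurable_fun_cvg _ _ _ _ hn) => [n|w _]; first by case: (hnP n).
apply/cvgrPdist_le => eps eps0.
have [M hM] : exists M : nat, forall i, l2norm (Z i w : 'cV[R]_h) <= M%:R.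
  exists (Num.truncn (\sum_i l2norm (Z i w : 'cV[R]_h))).+1 => j.
  apply/ltW/(le_lt_trans _ (truncnS_gt _)).
  by rewrite (bigD1 j)//= lerDl; apply: sumr_ge0 => l _; exact: l2norm_ge0.
near=> n.
have Mn : (M <= n)%N by near: n; exists M.
rewrite distrC; apply: (le_trans (proj2 (hnP n) w _)).
  by move=> i; apply: (le_trans (hM i)); rewrite ler_nat.
rewrite mulrA ler_pdivrMr// -ler_pdivrMl//.
near: n; exists (Num.truncn (eps^-1 * (`|K| * N%:R))) => // k /= Mk.
by apply/ltW/(lt_le_trans (truncnS_gt _)); rewrite ler_nat ltnS.
Unshelve. all: by end_near. Qed.

Lemma measurable_lipschitz1 (g : 'cV[R]_h -> R) (K : R) :
  (forall x y, `|g x - g y| <= K * l2norm (x - y)) ->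
  measurable_fun setT (g : T -> R).
Proof.
move=> gK; apply: (@measurable_lipschitz _ _ 1 (fun=> id) (fun z => g (z 0)) K).
  by move=> i; exact: measurable_id.
by move=> z z'; rewrite big_ord1.
Qed.

Lemma measurable_ball (G : R) : measurable [set x : T | l2norm (x : 'cV[R]_h) <= G].
Proof.
have m : measurable_fun setT (fun x : T => l2norm (x : 'cV[R]_h)).
  by apply: (@measurable_lipschitz1 _ 1) => x y; rewrite mul1r l2norm_dist.
have := m measurableT `]-oo, G]%classic (measurable_itv _); rewrite setTI.
by congr measurable; apply/seteqP; split => x /=; rewrite in_itv.
Qed.

End borel_cV_theory.

(** * Expectations *)

Section probability_facts.
Context (R : realType) (d : measure_display) (T : measurableType d)
  (P : probability T R).

Lemma measure_finite_valued (F : finType) (phi : T -> F) (B : pred F) :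
  (forall c, measurable (phi @^-1` [set c])) ->
  P (phi @^-1` [set c | B c]) = (\sum_(c | B c) P (phi @^-1` [set c]))%E.
Proof.
move=> mphi; pose r := [seq c <- enum F | B c].
rewrite (_ : _ @^-1` _ = \bigcup_(c in [set` r]) (phi @^-1` [set c])).
  rewrite measure_fin_bigcup//.
    rewrite -(@fsbig_seq _ _ _ _ r); last by rewrite filter_uniq// enum_uniq.
    by rewrite big_filter big_enum_cond.
  by move=> c c' _ _ [x [/= <- <-]].
apply/seteqP; split => [x /= Bx|x [c /=]].
  by exists (phi x) => //=; rewrite mem_filter Bx mem_enum.
by rewrite mem_filter => /andP[Bc _] ->.
Qed.

Lemma fine_probabilityK A : measurable A -> (fine (P A))%:E = P A.
Proof. by move=> mA; rewrite fineK// fin_num_measure. Qed.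

Lemma pmf_finite_valued (F : finType) (phi : T -> F) :
  (forall c, measurable (phi @^-1` [set c])) ->
  pmf (fun c => fine (P (phi @^-1` [set c]))).
Proof.
move=> mphi; split => [c|]; first exact/fine_ge0/measure_ge0.
apply: EFin_inj; rewrite -sumEFin.
under eq_bigr do rewrite fine_probabilityK//.
rewrite -(measure_finite_valued xpredT mphi) -(probability_setT P).
by congr (P _); apply/seteqP; split.
Qed.

Lemma ae_probability1 (A : set T) : measurable A -> P A = 1%E ->
  {ae P, forall x, A x}.
Proof.
move=> mA PA; exists (~` A); split => //; first exact: measurableC.
by rewrite probability_setC// PA subee.
Qed.

Lemma ae_bounded_integral_abs (f : T -> R) (b : R) : measurable_fun setT f ->
  0 <= b -> {ae P, forall x, `|f x| <= b} ->
  (\int[P]_x `|(f x)%:E| <= b%:E)%E.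
Proof.
move=> mf b0 fb; rewrite -[leRHS]mule1 -(probability_setT P).
apply: integral_le_bound => //; first exact/measurable_EFinP.
by apply: filterS fb => x xb _; rewrite /= lee_fin.
Qed.

Lemma ae_bounded_integrable (f : T -> R) (b : R) : measurable_fun setT f ->
  0 <= b -> {ae P, forall x, `|f x| <= b} -> P.-integrable setT (EFin \o f).
Proof.
move=> mf b0 fb; apply/integrableP; split; first exact/measurable_EFinP.
by apply: le_lt_trans (ae_bounded_integral_abs mf b0 fb) _; rewrite ltry.
Qed.

Lemma integral_finite_valued (F : finType) (phi : T -> F) (g : F -> R) :
  (forall c, measurable (phi @^-1` [set c])) ->
  (\int[P]_x (g (phi x))%:E)%E =
  (\sum_c fine (P (phi @^-1` [set c])) * g c)%:E.
Proof.
move=> mphi.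
transitivity (\int[P]_x (\sum_c ((g c)%:E * (\1_(phi @^-1` [set c]) x)%:E)))%E.
  apply: eq_integral => x _; rewrite (bigD1 (phi x))//= big1 => [|c /negP cx].
    by rewrite addr0 indicE mem_set// mule1.
  by rewrite indicE memNset ?mule0// => /= xc; apply: cx; rewrite xc.
have intc c : P.-integrable setT (fun x => (\1_(phi @^-1` [set c]) x)%:E).
  exact: integrable_indic.
rewrite integral_sum//; last by move=> c; exact: integrableZl.
rewrite -sumEFin; apply: eq_bigr => c _.
by rewrite integralZl// integral_indic// setIT EFinM muleC fine_probabilityK.
Qed.

Lemma integral_discretization (C : finType) (e : T -> C) (phi : C -> R)
    (A : set T) (f : T -> R) (b eta : R) :
  measurable_fun setT f -> (forall c, measurable (e @^-1` [set c])) ->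
  measurable A -> P A = 1%E -> 0 <= b -> 0 <= eta ->
  (forall x, A x -> `|f x| <= b) ->
  (forall x, A x -> `|f x - phi (e x)| <= eta) ->
  `|fine (\int[P]_x (f x)%:E)%E - \sum_c fine (P (e @^-1` [set c])) * phi c| <= eta.
Proof.
move=> mf me mA PA b0 eta0 fb feta.
have Aae := ae_probability1 mA PA.
have mphi : measurable_fun setT (phi \o e) := measurable_finite_valued phi me.
have intf : P.-integrable setT (EFin \o f).
  by apply: ae_bounded_integrable mf b0 _; exact: filterS fb Aae.
have mB : measurable_fun setT (f \- (phi \o e)) by exact: measurable_funB.
have intphi : P.-integrable setT (EFin \o (phi \o e)).
  apply: (@ae_bounded_integrable _ (b + eta)) => //; first exact: addr_ge0.
  apply: filterS Aae => x Ax; have := fb x Ax; have := feta x Ax.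
  by rewrite /= !ler_norml; lra.
have mB' : measurable_fun setT (EFin \o (f \- (phi \o e))) by exact/measurable_EFinP.
have aeB : {ae P, forall x, `|(f \- (phi \o e)) x| <= eta} by exact: filterS feta Aae.
have := le_trans (le_abse_integral P measurableT mB')
  (ae_bounded_integral_abs mB eta0 aeB).
under eq_integral do rewrite /= EFinB.
rewrite integralB_EFin// (integral_finite_valued phi me).
by rewrite -(fineK (integrable_fin_num _ intf))// -EFinB lee_fin.
Qed.

End probability_facts.

Lemma integral_empirical (R : realType) (h n : nat) (x : 'I_n -> borel_cV R h)
    (f : borel_cV R h -> R) : measurable_fun setT f ->
  (\int[empirical x]_y (f y)%:E)%E = (n%:R^-1 * \sum_(i < n) f (x i))%:E.
Proof.
move=> mf.
have n0 : 0 <= n%:R^-1 :> R by rewrite invr_ge0.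
pose dd j : {measure set (borel_cV R h) -> \bar R} :=
  if insub j is Some i then \d_(x i) else mzero.
have ge0E (g : borel_cV R h -> \bar R) : measurable_fun setT g ->
    (forall y, 0 <= g y)%E ->
    (\int[empirical x]_y g y)%E = ((n%:R^-1)%:E * \sum_(i < n) g (x i))%E.
  move=> mg g0.
  rewrite (@eq_measure_integral _ _ _ _ (mscale (NngNum n0) (msum dd n))).
    rewrite ge0_integral_mscale// ge0_integral_measure_sum//.
    congr (_ * _)%E; apply: eq_bigr => i _.
    by rewrite /dd valK integral_dirac// diracT mul1e.
  move=> A mA _; rewrite /= /empirical /mscale/= /msum.
  by congr (_ * _)%E; apply: eq_bigr => i _; rewrite /dd valK.
have mf' : measurable_fun setT (EFin \o f) by exact/measurable_EFinP.
rewrite integralE ge0E//; last exact: measurable_funepos.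
rewrite ge0E//; last exact: measurable_funeneg.
have -> : (\sum_(i < n) (EFin \o f)^\+ (x i) = (\sum_(i < n) Num.max (f (x i)) 0)%:E)%E.
  by rewrite -sumEFin; apply: eq_bigr => i _; rewrite funeposE/= EFin_max.
have -> : (\sum_(i < n) (EFin \o f)^\- (x i) = (\sum_(i < n) Num.max (- f (x i)) 0)%:E)%E.
  by rewrite -sumEFin; apply: eq_bigr => i _; rewrite funenegE/= EFin_max.
rewrite -!EFinM -EFinB -mulrBr -sumrB; congr (_ * _)%:E.
have maxB (a : R) : Num.max a 0 - Num.max (- a) 0 = a.
  have [a0|a0] := leP 0 a; first by rewrite max_r ?oppr_le0// subr0.
  by rewrite max_l ?oppr_ge0 ?ltW// sub0r opprK.
by apply: eq_bigr => i _; exact: maxB.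
Qed.

(** * Concentration of the supremum *)

Lemma sum_tupleS (R : nmodType) (C : finType) N (F : N.+1.-tuple C -> R) :
  \sum_t F t = \sum_c \sum_(t : N.-tuple C) F (cons_tuple c t).
Proof.
rewrite (pair_bigA _ (fun c t => F (cons_tuple c t)))/=.
rewrite (reindex (fun x : C * N.-tuple C => cons_tuple x.1 x.2))//.
exists (fun t => (thead t, behead_tuple t)) => [[c t] _ /=|t _ /=].
  by congr (_, _); apply: val_inj.
by rewrite [RHS]tuple_eta; apply: val_inj.
Qed.

(** Links the recursive expectation with the law of the tuple of cells visited by independent sample
    points. *)
Lemma prodE_tuple (R : realType) (C : finType) (p : nat -> C -> R) N
    (g : seq C -> R) :
  prodE p N g = \sum_(t : N.-tuple C) (\prod_(i < N) p i (tnth t i)) * g t.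
Proof.
elim: N p g => [|N IH] p g.
  rewrite (big_pred1 [tuple]) => [|t]; first by rewrite big_ord0 mul1r.
  by rewrite (tuple0 t); symmetry; exact: eqxx.
rewrite sum_tupleS /=; apply: eq_bigr => c _; rewrite IH mulr_sumr.
apply: eq_bigr => t _; rewrite mulrA big_ord_recl tnth0; congr (_ * _ * _).
by apply: eq_bigr => i _; rewrite tnthS.
Qed.

Lemma sup_range_dist (R : realType) (T : Type) (t0 : T) (u v : T -> R) (b c : R) :
  (forall t, u t <= b) -> (forall t, v t <= b) ->
  (forall t, `|u t - v t| <= c) -> `|sup (range u) - sup (range v)| <= c.
Proof.
move=> ub vb uvc.
have le_sup_range (f g : T -> R) : (forall t, g t <= b) ->
    (forall t, f t - g t <= c) -> sup (range f) - sup (range g) <= c.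
  move=> gb fgc; rewrite lerBlDr; apply: ge_sup; first by exists (f t0), t0.
  move=> _ [t _ <-]; rewrite -lerBlDl; apply: (@le_trans _ _ (g t)).
    by rewrite lerBlDl -lerBlDr.
  by apply: ub_le_sup; [exists b => _ [s _ <-]|exists t].
rewrite ler_norml lerNl opprB !le_sup_range//.
  by move=> t; apply: le_trans (uvc t); rewrite ler_norm.
by move=> t; rewrite -opprB; apply: le_trans (uvc t); rewrite -normrN ler_norm.
Qed.

Section concentration.
Context (R : realType) (h N : nat) (a : nat -> R)
  (pr : nat -> probability (borel_cV R h) R).
Context (dO : measure_display) (Omega : measurableType dO)
  (P : probability Omega R) (Z : 'I_N -> Omega -> borel_cV R h).
Context (T : Type) (t0 : T) (F : T -> 'cV[R]_h -> R) (G Lam K delta : R).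
Hypothesis mZ : forall i, measurable_fun setT (Z i).
Hypothesis lawZ : forall A : 'I_N -> set (borel_cV R h),
  (forall i, measurable (A i)) ->
  P (\bigcap_i (Z i @^-1` A i)) = (\prod_(i < N) pr i (A i))%E.
Hypothesis G_gt0 : 0 < G.
Hypothesis pr_ball : forall i, P_B G (pr i).
Hypothesis Lam_gt0 : 0 < Lam.
Hypothesis F_lip : forall t x y, `|F t x - F t y| <= Lam * l2norm (x - y).
Hypothesis F0 : forall t, F t 0 = 0.
Hypothesis K_gt1 : 1 < K.
Hypothesis delta01 : 0 < delta < 1.
Hypothesis F_mgf : forall (b : nat -> R) (x : nat -> 'cV[R]_h) (V : R)
    (t : seq bool -> T) (c : R),
  \sum_(i < N) l2norm (b i *: x i) ^+ 2 <= V -> 0 <= c ->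
  signE N (fun s => expR (c * `|\sum_(i < N) (-1) ^+ nth false s i *
    (b i * F (t s) (x i))|)) <=
  K * expR ((c * Lam) ^+ 2 * V / 2 + c * Lam * Num.sqrt V).

Let V := \sum_(i < N) a i ^+ 2.
Hypothesis V_gt0 : 0 < V.

Definition exact_mean (i : nat) (t : T) : R := fine (\int[pr i]_x (F t x)%:E)%E.

Let ball : set (borel_cV R h) := [set x | l2norm (x : 'cV[R]_h) <= G].

Let mball : measurable ball. Proof. exact: measurable_ball. Qed.

Lemma F_le t x : `|F t x| <= Lam * l2norm x.
Proof. by have := F_lip t x 0; rewrite F0 !subr0. Qed.

Lemma measurable_F t : measurable_fun setT (F t : borel_cV R h -> R).
Proof. exact: measurable_lipschitz1 (F_lip t). Qed.

Lemma F_le_ball t x : ball x -> `|F t x| <= Lam * G.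
Proof. by move=> xG; apply: (le_trans (F_le t x)); rewrite ler_pM2l. Qed.

Lemma exact_meanE i t : (\int[pr i]_x (F t x)%:E)%E = (exact_mean i t)%:E.
Proof.
rewrite fineK//; apply: integrable_fin_num => //.
apply: (@ae_bounded_integrable _ _ _ _ _ (Lam * G)).
- exact: measurable_F.
- by rewrite mulr_ge0// ltW.
- by apply: filterS (ae_probability1 mball (pr_ball i)) => x; exact: F_le_ball.
Qed.

Lemma exact_mean_le i t : `|exact_mean i t| <= Lam * G.
Proof.
have LG0 : 0 <= Lam * G by rewrite mulr_ge0// ltW.
have mF := measurable_F t.
rewrite -lee_fin -abse_EFin -exact_meanE.
apply: (le_trans (le_abse_integral _ measurableT _)); first exact/measurable_EFinP.
apply: ae_bounded_integral_abs => //.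
by apply: filterS (ae_probability1 mball (pr_ball i)) => x; exact: F_le_ball.
Qed.

Definition population_sup : R :=
  sup (range (fun t => `|\sum_(i < N) a i * exact_mean i t|)).

Definition sample_sup (z : 'I_N -> 'cV[R]_h) : R :=
  sup (range (fun t => `|\sum_(i < N) a i * F t (z i)|)).

Lemma weighted_mean_le t :
  `|\sum_(i < N) a i * exact_mean i t| <= \sum_(i < N) `|a i| * (Lam * G).
Proof.
apply: (le_trans (ler_norm_sum _ _ _)); apply: ler_sum => i _.
by rewrite normrM ler_wpM2l// exact_mean_le.
Qed.

Lemma weighted_sample_le t (z : 'I_N -> 'cV[R]_h) :
  `|\sum_(i < N) a i * F t (z i)| <= \sum_(i < N) `|a i| * (Lam * l2norm (z i)).
Proof.
apply: (le_trans (ler_norm_sum _ _ _)); apply: ler_sum => i _.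
by rewrite normrM ler_wpM2l// F_le.
Qed.

(** A supremum of uniformly Lipschitz functions is Lipschitz; this makes a supremum over uncountably
    many networks measurable. *)
Lemma sample_sup_lipschitz z z' : `|sample_sup z - sample_sup z'| <=
  (\sum_(i < N) `|a i|) * Lam * \sum_i l2norm (z i - z' i).
Proof.
apply: (@sup_range_dist _ _ t0 _ _ (\sum_(i < N) `|a i| * (Lam * l2norm (z i)) +
    \sum_(i < N) `|a i| * (Lam * l2norm (z' i)))) => t.
- apply: (le_trans (weighted_sample_le _ _)); rewrite lerDl.
  by apply: sumr_ge0 => i _; rewrite !mulr_ge0 ?l2norm_ge0// ltW.
- apply: (le_trans (weighted_sample_le _ _)); rewrite lerDr.
  by apply: sumr_ge0 => i _; rewrite !mulr_ge0 ?l2norm_ge0// ltW.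
apply: (le_trans (ler_dist_dist _ _)); rewrite -sumrB -mulrA mulr_suml.
apply: (le_trans (ler_norm_sum _ _ _)); apply: ler_sum => i _.
rewrite -mulrBr normrM ler_wpM2l//; apply: (le_trans (F_lip _ _ _)).
rewrite ler_pM2l// (bigD1 i)//= lerDl.
by apply: sumr_ge0 => j _; exact: l2norm_ge0.
Qed.

Let Zs w i : 'cV[R]_h := Z i w.

Let gap w := `|population_sup - sample_sup (Zs w)|.

Lemma measurable_gap : measurable_fun setT gap.
Proof.
apply: measurableT_comp => //; apply: measurable_funB => //.
exact: measurable_lipschitz mZ sample_sup_lipschitz.
Qed.

Lemma measurable_gap_gt (c : R) : measurable [set w | c < gap w].
Proof.
have mI : measurable (`]c, +oo[%classic : set R) by exact: measurable_itv.
have := measurable_gap measurableT mI.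
by rewrite setTI; congr measurable; apply/seteqP; split => x /=; rewrite in_itv/= andbT.
Qed.

Let B0 := Lam * G * Num.sqrt V *
  (2 * (Num.sqrt (2 * ln K) + 1) + Num.sqrt (2 * ln (1 / delta))).

(** While all points stay in the ball, which is almost sure, the gap is at most the finite supremum
    of deviations plus discretization errors: [Lam * eps] for each mean and as much for each sample
    value. *)
Lemma gap_tail_discretized (eps : R) : 0 < eps ->
  (P [set w | (B0 + (\sum_(i < N) `|a i|) * (2 * (Lam * eps)) < gap w)%R] <= delta%:E)%E.
Proof.
move=> eps0.
have [C [e [rep [me repG repe]]]] := @finite_discretization R h G eps (ltW G_gt0) eps0.
pose c0 : C := e (0 : 'cV[R]_h).
pose p i c := fine (pr i (e @^-1` [set c])).
pose f t c := F t (rep c).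
have pmf_p i : pmf (p i) by exact: pmf_finite_valued.
have LG : 0 < Lam * G by rewrite mulr_gt0.
have f_le t c : `|f t c| <= Lam * G by apply: F_le_ball; exact: repG.
have mgf (x : nat -> C) (t : seq bool -> T) (c : R) : 0 <= c ->
  signE N (fun e => expR (c * `|\sum_(i < N) (-1) ^+ nth false e i *
                                  (a i * f (t e) (x i))|)) <=
  K * expR ((c * (Lam * G)) ^+ 2 * V / 2 + c * (Lam * G) * Num.sqrt V).
  move=> c_ge0.
  have xV : \sum_(i < N) l2norm (a i *: (rep (x i) : 'cV[R]_h)) ^+ 2 <= G ^+ 2 * V.
    rewrite mulr_sumr; apply: ler_sum => i _.
    rewrite l2normZ exprMn real_normK ?num_real// mulrC ler_wpM2r ?sqr_ge0//.
    by rewrite ler_pXn2r ?nnegrE ?l2norm_ge0 ?(ltW G_gt0)// repG.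
  apply: (le_trans (@F_mgf a (fun i => rep (x i)) _ t c xV c_ge0)).
  rewrite sqrtrM ?sqr_ge0// sqrtr_sqr (ger0_norm (ltW G_gt0)) le_eqVlt.
  by apply/orP; left; apply/eqP; congr (_ * expR _); ring.
have tail := sup_deviation_tail c0 t0 pmf_p LG f_le V_gt0 K_gt1 delta01 mgf.
rewrite -/V -/B0 in tail.
pose sd := sup_deviation c0 N p a f.
pose phi w := [tuple e (Z i w) | i < N].
have mphi (t : N.-tuple C) : measurable (phi @^-1` [set t]).
  exact: measurable_cells mZ me t.
have bad : (P (phi @^-1` [set t : N.-tuple C | (B0 < sd t)%R]) <= delta%:E)%E.
  rewrite (measure_finite_valued P (fun t : N.-tuple C => B0 < sd t) mphi).
  apply: (@le_trans _ _ (prodE p N (fun s => (B0 < sd s)%R%:R))%:E); last first.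
    by rewrite lee_fin.
  rewrite prodE_tuple -sumEFin big_mkcond; apply: lee_sum => t _.
  case: ifPn => _; last by rewrite mulr0.
  rewrite mulr1 (_ : phi @^-1` _ = \bigcap_i (Z i @^-1` (e @^-1` [set tnth t i]))).
    rewrite lawZ// (eq_bigr (fun i => (p (nat_of_ord i) (tnth t i))%:E))
      ?prodEFin// => i _.
    by rewrite fine_probabilityK.
  apply/seteqP; split => [w /= <- i _ /=|w /= wt]; first by rewrite tnth_mktuple.
  by apply: eq_from_tnth => i; rewrite tnth_mktuple; exact: (wt i I).
pose good := \bigcap_i (Z i @^-1` ball).
have mgood : measurable good.
  apply: fin_bigcap_measurable => // i _.
  by rewrite -[X in measurable X]setTI; exact: mZ.
have Pgood : P (~` good) = 0%E.
  rewrite probability_setC// lawZ// big1 ?subee// => i _; exact: pr_ball.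
have mbad : measurable (phi @^-1` [set t : N.-tuple C | (B0 < sd t)%R]).
  have := @measurable_finite_valued _ _ _ phi _ bool
    (fun t : N.-tuple C => B0 < sd t) mphi.
  by move=> /(_ measurableT [set true] I); rewrite setTI.
apply: (@le_trans _ _ (P (phi @^-1` [set t : N.-tuple C | (B0 < sd t)%R] `|` ~` good))).
  apply: le_measure; rewrite ?inE.
  - exact: measurable_gap_gt.
  - by apply: measurableU => //; exact: measurableC.
  move=> w /= wB; have [gw|] := pselect (good w); last by right.
  left => /=; rewrite -(ltrD2r ((\sum_(i < N) `|a i|) * (2 * (Lam * eps)))).
  apply: (lt_le_trans wB).
  have mean_close i t : `|exact_mean i t - \sum_c p i c * f t c| <= Lam * eps.
    apply: (@integral_discretization _ _ _ (pr i) C e (f t) ball (F t) (Lam * G)) => //.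
    - exact: measurable_F.
    - exact: pr_ball.
    - exact: ltW.
    - by rewrite mulr_ge0// ltW.
    - by move=> x; exact: F_le_ball.
    - move=> x xG; apply: (le_trans (F_lip _ _ _)); rewrite ler_pM2l//.
      by rewrite -l2normN opprB repe.
  have sd_le t : `|deviation c0 N p a f t (phi w)| <= sd (phi w).
    exact: deviation_le_sup pmf_p f_le _ _.
  apply: (@sup_range_dist _ _ t0 _ _ (\sum_(i < N) `|a i| * (Lam * G))) => t.
  - exact: weighted_mean_le.
  - apply: (le_trans (weighted_sample_le _ _)); apply: ler_sum => i _.
    by rewrite ler_wpM2l// ler_pM2l//; exact: (gw i I).
  apply: (le_trans (ler_dist_dist _ _)); rewrite -sumrB.
  apply: (le_trans _ (lerD (sd_le t) (lexx _))).
  rewrite (_ : \sum_(i < N) _ = deviation c0 N p a f t (phi w) +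
    \sum_(i < N) a i * ((exact_mean i t - \sum_c p i c * f t c) +
                        (f t (e (Z i w)) - F t (Zs w i)))); last first.
    rewrite /deviation -big_split/=; apply: eq_bigr => i _.
    have -> : nth c0 (phi w) i = e (Z i w) by rewrite -tnth_nth tnth_mktuple.
    by ring.
  apply: (le_trans (ler_normD _ _)); rewrite lerD2l mulr_suml.
  apply: (le_trans (ler_norm_sum _ _ _)); apply: ler_sum => i _.
  rewrite normrM ler_wpM2l// mulr_natl mulr2n.
  apply: (le_trans (ler_normD _ _)); apply: lerD => //.
  by apply: (le_trans (F_lip _ _ _)); rewrite ler_pM2l// repe//; exact: (gw i I).
apply: (le_trans (measureU2 _ _ _)) => //; first exact: measurableC.
by rewrite [X in (_ + X)%E]Pgood adde0.
Qed.

(** The event that the gap exceeds [B] strictly is the increasing union of the events that it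
    exceeds [B + 1 / (k + 1)]; a fine enough mesh bounds each of these by [delta]. *)
Lemma gap_concentration (B : R) : B0 <= B ->
  with_probability_at_least P (1 - delta) [set w | gap w <= B].
Proof.
move=> BB.
have mlt := measurable_gap_gt.
have leC c : [set w | gap w <= c] = ~` [set w | c < gap w].
  by apply/seteqP; split => w /=; rewrite leNgt => /negP.
split; first by rewrite leC; exact: measurableC.
rewrite leC probability_setC// EFinB leeB//.
pose S k := [set w | B + k.+1%:R^-1 < gap w].
have SE : [set w | B < gap w] = \bigcup_k S k.
  apply/seteqP; split => [w /= lt|w [k _ /= lt]]; last first.
    by apply: lt_trans lt; rewrite ltrDl invr_gt0.
  have g0 : 0 < gap w - B by rewrite subr_gt0.
  exists (Num.truncn (gap w - B)^-1) => //; rewrite /S/= -ltrBrDl.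
  rewrite -[ltRHS]invrK ltf_pV2 ?posrE ?invr_gt0//.
  exact: truncnS_gt.
have Sle k : (P (S k) <= delta%:E)%E.
  pose A := \sum_(i < N) `|a i|.
  have A0 : 0 <= A by exact: sumr_ge0.
  (* Makes the discretization error [1 / (k + 1)] times [A / (A + 1)], hence at most
     [1 / (k + 1)]. *)
  pose eps := k.+1%:R^-1 / (2 * Lam * (A + 1)).
  have den : 0 < 2 * Lam * (A + 1) by rewrite !mulr_gt0// ltr_wpDl.
  have eps0 : 0 < eps by rewrite divr_gt0.
  apply: (le_trans _ (gap_tail_discretized eps0)).
  apply: le_measure; rewrite ?inE; [exact: mlt|exact: mlt|].
  move=> w /=; apply: le_lt_trans; apply: lerD => //.
  have -> : A * (2 * (Lam * eps)) = k.+1%:R^-1 * (A / (A + 1)).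
    have A1 : A + 1 != 0 by rewrite gt_eqF// ltr_wpDl.
    have L0 : Lam != 0 by rewrite gt_eqF.
    by rewrite /eps; set r := k.+1%:R^-1; field; rewrite A1 L0.
  rewrite ler_piMr// ler_pdivrMr ?mul1r ?lerDl//.
  by rewrite ltr_wpDl.
have ndS : nondecreasing_seq S.
  move=> i j ij; apply/subsetPset => w /=; apply: le_lt_trans.
  by rewrite lerD2l lef_pV2 ?posrE// ler_nat ltnS.
have := @nondecreasing_cvg_mu _ _ _ P S (fun k => mlt _).
rewrite -SE => /(_ (mlt B) ndS) cv.
rewrite -(cvg_lim _ cv)//; apply: lime_le.
  by apply/cvg_ex; exists (P [set w | B < gap w]).
by apply: nearW => k; exact: Sle.
Qed.

End concentration.

(** * Networks and the two samples *)

Lemma nn_distance_range (R : realType) (h : nat) (T : Type) (t0 : T)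
    (F : T -> 'cV[R]_h -> R) (mu nu : {measure set (borel_cV R h) -> \bar R})
    (u v : T -> R) (b : R) :
  (forall t, \int[mu]_x (F t x)%:E = (u t)%:E)%E ->
  (forall t, \int[nu]_x (F t x)%:E = (v t)%:E)%E ->
  (forall t, `|u t - v t| <= b) ->
  nn_distance (range F) mu nu = (sup (range (fun t => `|u t - v t|)))%:E.
Proof.
move=> muF nuF uvb.
rewrite -ereal_sup_EFin; first last.
- by exists (`|u t0 - v t0|), t0.
- by exists b => _ [t _ <-].
congr ereal_sup; apply/seteqP; split => [_ [_ [t _ <-] <-]|_ [_ [t _ <-] <-]].
  by exists (`|u t - v t|); [exists t|rewrite muF nuF].
by exists (F t); [exists t|rewrite muF nuF].
Qed.

Section two_samples.
Context (R : realType) (h n m : nat).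

Definition sample_weight (i : nat) : R := if (i < n)%N then n%:R^-1 else - m%:R^-1.

Definition pooled (T : Type) (x : 'I_n -> T) (y : 'I_m -> T) (i : 'I_(n + m)) : T :=
  match fintype.split i with inl i => x i | inr j => y j end.

Lemma pooled_lshift T (x : 'I_n -> T) (y : 'I_m -> T) i : pooled x y (lshift m i) = x i.
Proof. by rewrite /pooled (unsplitK (inl i)). Qed.

Lemma pooled_rshift T (x : 'I_n -> T) (y : 'I_m -> T) j : pooled x y (rshift n j) = y j.
Proof. by rewrite /pooled (unsplitK (inr j)). Qed.

Lemma sample_weight_sum (c : 'I_(n + m) -> R) :
  \sum_(i < n + m) sample_weight i * c i =
  n%:R^-1 * (\sum_i c (lshift m i)) - m%:R^-1 * (\sum_j c (rshift n j)).
Proof.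
rewrite big_split_ord/= -mulNr !mulr_sumr; congr (_ + _); apply: eq_bigr => i _.
  by rewrite /sample_weight ltn_ord.
by rewrite /sample_weight ltnNge leq_addr.
Qed.

Lemma sample_weight_sqr : (0 < n)%N -> (0 < m)%N ->
  \sum_(i < n + m) sample_weight i ^+ 2 = n%:R^-1 + m%:R^-1.
Proof.
move=> n0 m0; under eq_bigr do rewrite expr2.
rewrite (sample_weight_sum (fun i => sample_weight i)).
have -> : \sum_(i < n) sample_weight (lshift m i) = n%:R * n%:R^-1.
  rewrite -[n in n%:R * _](card_ord n) mulr_natl -sumr_const.
  by apply: eq_bigr => i _; rewrite /sample_weight/= ltn_ord.
have -> : \sum_(j < m) sample_weight (rshift n j) = m%:R * - m%:R^-1.
  rewrite -[m in m%:R * _](card_ord m) mulr_natl -sumr_const.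
  by apply: eq_bigr => i _; rewrite /sample_weight/= ltnNge leq_addr.
by rewrite mulrN mulrN opprK !divff ?pnatr_eq0 -?lt0n// !mulr1.
Qed.

Context (dO : measure_display) (Omega : measurableType dO) (P : probability Omega R).
Context (dT : measure_display) (T : measurableType dT) (mu nu : probability T R).
Context (X : 'I_n -> {mfun Omega >-> T}) (Y : 'I_m -> {mfun Omega >-> T}).
Hypothesis hXY : independent_samples P mu nu X Y.

Definition pooled_law (i : nat) : probability T R := if (i < n)%N then mu else nu.

Definition pooled_sample (i : 'I_(n + m)) (w : Omega) : T :=
  pooled (fun i => X i w) (fun j => Y j w) i.

Lemma measurable_pooled_sample i : measurable_fun setT (pooled_sample i).
Proof.
by rewrite /pooled_sample /pooled; case: fintype.split => j; exact: measurable_funP.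
Qed.

Lemma pooled_sample_law (A : 'I_(n + m) -> set T) : (forall i, measurable (A i)) ->
  P (\bigcap_i (pooled_sample i @^-1` A i)) = (\prod_(i < n + m) pooled_law i (A i))%E.
Proof.
move=> mA; have [lawX lawY ind] := hXY.
have := ind [set: 'I_n + 'I_m]%SET (fun s => A (unsplit s)) (fun s _ => mA _).
rewrite (_ : \bigcap_(i in _) _ = \bigcap_i (pooled_sample i @^-1` A i)); last first.
  apply/seteqP; split => [w wA i _|w wA s _].
    have := wA (fintype.split i); rewrite /= inE splitK /pooled_sample /pooled /=.
    by case: (fintype.split i) => j; apply.
  have := wA (unsplit s) I; rewrite /pooled_sample /pooled /= unsplitK.
  by case: s.
move=> ->; rewrite (reindex (@unsplit n m)) /=; last first.
  by exists (@fintype.split n m) => i _; [exact: unsplitK|exact: splitK].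
apply: eq_big => [s|s _]; first by rewrite inE.
case: s => j /=; rewrite /pooled_law.
  by rewrite ltn_ord; exact: lawX.
by rewrite ltnNge leq_addr; exact: lawY.
Qed.

End two_samples.

Lemma sqrt_inv_sum_le (R : realType) (n m : nat) : (0 < n)%N -> (0 < m)%N ->
  Num.sqrt (n%:R^-1 + m%:R^-1) <= (Num.sqrt n%:R)^-1 + (Num.sqrt m%:R)^-1 :> R.
Proof.
move=> n0 m0.
have s0 (k : nat) : 0 <= (Num.sqrt k%:R)^-1 :> R by rewrite invr_ge0 sqrtr_ge0.
rewrite -(@ler_pXn2r _ 2)// ?nnegrE ?sqrtr_ge0 ?addr_ge0//.
rewrite sqr_sqrtr ?addr_ge0 ?invr_ge0// sqrrD !exprVn !sqr_sqrtr//.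
by rewrite -addrA [leRHS]addrCA -addrA; have := mulr_ge0 (s0 n) (s0 m); lra.
Qed.

Section neural_network_distance.
Context (R : realType) (d : nat) (k : nat -> nat) (sigma : nat -> R -> R)
  (L M : nat -> R).
Context (nrm rn : forall p, 'cV[R]_p -> R)
  (mn : forall p q, 'M[R]_(p, q) -> R) (good : (R -> R) -> Prop)
  (K0 : nat -> R) (norms : layer_norms nrm rn mn good K0).
Hypothesis d_gt0 : (0 < d)%N.
Hypothesis k1_gt0 : (0 < k 1)%N.
Hypothesis M_gt0 : forall i, (1 <= i <= d)%N -> 0 < M i.
Hypothesis sigmaA : assumption_A d sigma L.
Hypothesis sigma_good : forall i, (1 <= i < d)%N -> good (sigma i).
Hypothesis rn0 : rn (0 : 'cV[R]_(k d.-1.+1)) <= 0.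
Hypothesis mn0 : forall p q, mn (0 : 'M[R]_(p, q)) <= 0.
Context (n m : nat) (G delta : R) (mu nu : probability (borel_cV R (k 1)) R)
  (dO : measure_display) (Omega : measurableType dO) (P : probability Omega R)
  (X : 'I_n -> {mfun Omega >-> borel_cV R (k 1)})
  (Y : 'I_m -> {mfun Omega >-> borel_cV R (k 1)}).
Hypothesis n_gt0 : (0 < n)%N.
Hypothesis m_gt0 : (0 < m)%N.
Hypothesis G_gt0 : 0 < G.
Hypothesis mu_ball : P_B G mu.
Hypothesis nu_ball : P_B G nu.
Hypothesis hXY : independent_samples P mu nu X Y.
Hypothesis delta01 : 0 < delta < 1.
Hypothesis K_gt1 : 1 < 2 ^+ d.-1 * K0 (k 1).

Lemma network_gainE : network_gain d L M =
  (\prod_(1 <= i < d.+1) M i) * \prod_(1 <= i < d) L i.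
Proof.
rewrite /network_gain /layer_gain; case: d d_gt0 => // d' _ /=.
by rewrite big_split/= [in RHS]big_nat_recr//=; ring.
Qed.

Lemma network_distance_concentration (B : R) :
  let Fnn := F_nn sigma (@admissible R d k M rn mn) in
  network_gain d L M * G *
    (2 * (Num.sqrt (2 * ln (2 ^+ d.-1 * K0 (k 1))) + 1) +
     Num.sqrt (2 * ln (1 / delta))) *
    ((Num.sqrt n%:R)^-1 + (Num.sqrt m%:R)^-1) <= B ->
  with_probability_at_least P (1 - delta)
    [set w | (`|nn_distance Fnn mu nu
              - nn_distance Fnn (empirical (fun i => X i w))
                                (empirical (fun j => Y j w))| <= B%:E)%E].
Proof.
move=> Fnn BB.
have L_gt0 i : (1 <= i < d)%N -> 0 < L i by move=> /sigmaA[].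
have sigma_lip i : (1 <= i < d)%N ->
    forall x y, `|sigma i x - sigma i y| <= L i * `|x - y|.
  by move=> /sigmaA[_ _ _ _ lip] x y; exact: (lip (x, y)).
(* As a subtype, the class becomes the range of a family over a whole type; the zero parameters
   inhabit it. *)
pose T := {p : parameters R d k | @admissible R d k M rn mn p}.
pose F (t : T) := network sigma (sval t).
have adm0 : @admissible R d k M rn mn ((fun i => 0), 0).
  split => [i id|/=]; first by apply: (le_trans (mn0 _ _)); rewrite ltW// M_gt0//;
    case/andP: id => -> /ltnW.
  by apply: (le_trans rn0); rewrite ltW// M_gt0// d_gt0 leqnn.
pose t0 : T := exist _ _ adm0.
have FE : Fnn = range F.
  apply/seteqP; split => [_ [p adp <-]|_ [[p adp] _ <-]]; last by exists p.
  by exists (exist _ p adp).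
have gain0 := network_gain_gt0 d_gt0 M_gt0 L_gt0.
have F_lip (t : T) x y : `|F t x - F t y| <= network_gain d L M * l2norm (x - y).
  by case: t => p adp; exact: (network_lipschitz norms d_gt0 M_gt0 L_gt0 sigma_lip).
have F0 (t : T) : F t 0 = 0 by exact: (network0 norms d_gt0 sigma_good).
have F_mgf (b : nat -> R) (x : nat -> 'cV[R]_(k 1)) (V : R)
    (t : seq bool -> T) (c : R) :
  \sum_(i < n + m) l2norm (b i *: x i) ^+ 2 <= V -> 0 <= c ->
  signE (n + m) (fun s => expR (c * `|\sum_(i < n + m) (-1) ^+ nth false s i *
    (b i * F (t s) (x i))|)) <=
  2 ^+ d.-1 * K0 (k 1) * expR ((c * network_gain d L M) ^+ 2 * V / 2 +
                               c * network_gain d L M * Num.sqrt V).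
  move=> bV c0.
  exact: (network_mgf norms d_gt0 k1_gt0 M_gt0 L_gt0 sigma_lip sigma_good bV
    (fun s => svalP (t s)) c0).
pose a := sample_weight R n m.
have aV : \sum_(i < n + m) a i ^+ 2 = n%:R^-1 + m%:R^-1 by exact: sample_weight_sqr.
have V0 : 0 < \sum_(i < n + m) a i ^+ 2 by rewrite aV addr_gt0// invr_gt0 ltr0n.
pose pr := pooled_law n mu nu.
have pr_ball i : P_B G (pr i) by rewrite /pr /pooled_law; case: ifP.
have := @gap_concentration R (k 1) (n + m) a pr _ _ P (pooled_sample X Y) T t0 F G
  (network_gain d L M) (2 ^+ d.-1 * K0 (k 1)) delta (measurable_pooled_sample X Y)
  (pooled_sample_law hXY) G_gt0 pr_ball gain0 F_lip F0 K_gt1 delta01 F_mgf V0 B.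
rewrite aV.
have B0B : network_gain d L M * G * Num.sqrt (n%:R^-1 + m%:R^-1) *
    (2 * (Num.sqrt (2 * ln (2 ^+ d.-1 * K0 (k 1))) + 1) +
     Num.sqrt (2 * ln (1 / delta))) <= B.
  apply: le_trans BB; rewrite mulrAC ler_wpM2l ?sqrt_inv_sum_le//.
  apply: mulr_ge0; first exact/ltW/mulr_gt0.
  apply: addr_ge0; last exact: sqrtr_ge0.
  by apply: mulr_ge0 => //; apply: addr_ge0 => //; exact: sqrtr_ge0.
move=> /(_ B0B); congr (with_probability_at_least _ _ _).
(* Indices 0 and [n] represent the two populations: [pooled_law] is [mu] below [n] and [nu] from [n]
   on. *)
have popE t : \sum_(i < n + m) a i * exact_mean pr F i t =
    exact_mean pr F 0 t - exact_mean pr F n t.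
  have cst_mean l (x : R) : (0 < l)%N -> l%:R^-1 * \sum_(i < l) x = x.
    move=> l0; rewrite sumr_const card_ord -[X in _ * X]mulr_natl.
    by rewrite mulKf// pnatr_eq0 -lt0n.
  rewrite sample_weight_sum; congr (_ - _).
    rewrite (eq_bigr (fun=> exact_mean pr F 0 t)) ?cst_mean// => i _.
    by rewrite /exact_mean /pr /pooled_law /= ltn_ord n_gt0.
  rewrite (eq_bigr (fun=> exact_mean pr F n t)) ?cst_mean// => i _.
  by rewrite /exact_mean /pr /pooled_law /= ltnNge leq_addr ltnn.
have sampE w t : \sum_(i < n + m) a i * F t (pooled_sample X Y i w) =
    n%:R^-1 * (\sum_i F t (X i w)) - m%:R^-1 * (\sum_j F t (Y j w)).
  rewrite sample_weight_sum; congr (_ * _ - _ * _); apply: eq_bigr => i _.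
    by rewrite /pooled_sample pooled_lshift.
  by rewrite /pooled_sample pooled_rshift.
have meanE := exact_meanE G_gt0 pr_ball gain0 F_lip F0.
have dist1 : nn_distance Fnn mu nu = (population_sup (n + m) a pr F)%:E.
  rewrite FE (@nn_distance_range _ _ _ t0 F mu nu (exact_mean pr F 0)
    (exact_mean pr F n) (\sum_(i < n + m) `|a i| * (network_gain d L M * G))).
  - congr (sup _)%:E; apply/seteqP; split => _ [t _ <-]; exists t => //.
      by rewrite popE.
    by rewrite popE.
  - by move=> t; have := meanE 0%N t; rewrite /pr /pooled_law n_gt0.
  - by move=> t; have := meanE n t; rewrite /pr /pooled_law ltnn.
  - by move=> t; rewrite -popE; exact: weighted_mean_le.
have mF t := measurable_F F_lip t.
have dist2 w : nn_distance Fnn (empirical (fun i => X i w))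
    (empirical (fun j => Y j w)) =
    (sample_sup a F (fun i => pooled_sample X Y i w))%:E.
  rewrite FE (@nn_distance_range _ _ _ t0 F _ _
    (fun t => n%:R^-1 * \sum_i F t (X i w)) (fun t => m%:R^-1 * \sum_j F t (Y j w))
    (\sum_(i < n + m) `|a i| * (network_gain d L M *
       l2norm (pooled_sample X Y i w : 'cV[R]_(k 1))))).
  - congr (sup _)%:E; apply/seteqP; split => _ [t _ <-]; exists t => //.
      by rewrite sampE.
    by rewrite sampE.
  - by move=> t; exact: integral_empirical.
  - by move=> t; exact: integral_empirical.
  - by move=> t; rewrite -sampE; exact: weighted_sample_le.
apply/seteqP; split => w /=; rewrite dist1 dist2 -EFinB abse_EFin lee_fin//.
Qed.

End neural_network_distance.

(** * Comparison with the stated constants *)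

Lemma ln2_le1 (R : realType) : ln (2 : R) <= 1.
Proof. by rewrite -[X in ln X]/(1 + 1 : R) le_ln1Dx// (lt_le_trans _ ler01)// ltrN10. Qed.

Lemma ln_pow2M (R : realType) (d : nat) (c : R) : 0 < c ->
  ln (2 ^+ d * c) = d%:R * ln 2 + ln c.
Proof.
by move=> c0; rewrite lnM ?posrE ?exprn_gt0// lnXn// mulr_natl.
Qed.

Unset Implicit Arguments.
Set Strict Implicit.

Theorem theorem4 (R : realType) (d : nat) (k : nat -> nat) (n m : nat)
    (sigma : nat -> R -> R) (L MF M1oo : nat -> R) (GammaB : R)
    (mu nu : probability (borel_cV R (k 1%N)) R)
    (dO : measure_display) (Omega : measurableType dO)
    (P : probability Omega R)
    (X : 'I_n -> {mfun Omega >-> borel_cV R (k 1%N)})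
    (Y : 'I_m -> {mfun Omega >-> borel_cV R (k 1%N)})
    (delta : R)
    (hd : (2 <= d)%N)
    (hk : forall i, (1 <= i <= d)%N -> (1 <= k i)%N)
    (hn : (1 <= n)%N) (hm : (1 <= m)%N)
    (hMF : forall i, (1 <= i <= d)%N -> 0 < MF i)
    (hM1oo : forall i, (1 <= i <= d)%N -> 0 < M1oo i)
    (hA : assumption_A d sigma L)
    (hB : assumption_B d sigma)
    (hGammaB : 0 < GammaB)
    (hmu : P_B GammaB mu) (hnu : P_B GammaB nu)
    (hXY : independent_samples P mu nu X Y)
    (hdelta : 0 < delta < 1) :
  ((forall i, (1 <= i < d)%N -> forall alpha x : R, 0 < alpha ->
      sigma i (alpha * x) = alpha * sigma i x) ->
   let F := F_nn sigma (@W_F R d k MF) in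
   with_probability_at_least P (1 - delta)
     [set omega |
       (`| nn_distance F mu nu
           - nn_distance F (empirical (fun i => X i omega))
                           (empirical (fun j => Y j omega)) |
        <= (Num.sqrt 2 * GammaB * (\prod_(1 <= i < d.+1) MF i)
            * (\prod_(1 <= i < d) L i)
            * (2 * Num.sqrt (d%:R * ln 2) + Num.sqrt (ln (1 / delta))
               + Num.sqrt 2)
            * ((Num.sqrt n%:R)^-1 + (Num.sqrt m%:R)^-1))%:E)%E])
  /\
  ((forall i, (1 <= i < d)%N -> sigma i 0 = 0) ->
   let F := F_nn sigma (@W_1oo R d k M1oo) in
   with_probability_at_least P (1 - delta)
     [set omega |
       (`| nn_distance F mu nu
           - nn_distance F (empirical (fun i => X i omega))
                           (empirical (fun j => Y j omega)) |
        <= (GammaB * (\prod_(1 <= i < d.+1) M1oo i)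
            * (\prod_(1 <= i < d) L i)
            * (4 * Num.sqrt (d%:R + 1 + ln (k 1%N)%:R)
               + Num.sqrt (2 * ln (1 / delta)))
            * ((Num.sqrt n%:R)^-1 + (Num.sqrt m%:R)^-1))%:E)%E]).
Proof.
have d0 : (0 < d)%N by exact: ltnW.
have k1 : (0 < k 1)%N by apply: hk; rewrite leqnn.
have ln2_gt0 : 0 < ln 2 :> R by rewrite ln_gt0// ltr1n.
(* Depth at least 2 provides the condition [1 < K] of the concentration bound. *)
have pow_gt1 : 1 < 2 ^+ d.-1 :> R by rewrite exprn_egt1 ?ltr1n// -lt0n -subn1 subn_gt0.
have lnd0 : 0 <= ln (1 / delta).
  case/andP: hdelta => de0 de1; apply: ln_ge0.
  by rewrite ler_pdivlMr// mul1r ltW.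
have rest_ge0 (M : nat -> R) : (forall i, (1 <= i <= d)%N -> 0 < M i) ->
    0 < network_gain d L M * GammaB.
  move=> M0; rewrite mulr_gt0// network_gain_gt0// => i /hA[]//.
have s_ge0 : 0 <= (Num.sqrt n%:R)^-1 + (Num.sqrt m%:R)^-1 :> R.
  by rewrite addr_ge0// invr_ge0 sqrtr_ge0.
split=> hs F.
- have K1 : 1 < 2 ^+ d.-1 * 1 :> R by rewrite mulr1.
  have rn0 : @l2norm R _ (0 : 'cV[R]_(k d.-1.+1)) <= 0 by rewrite l2norm0.
  have mn0 p q : @frobenius R p q 0 <= 0.
    rewrite /frobenius big1 ?sqrtr0// => i _.
    by rewrite big1// => j _; rewrite mxE expr0n.
  apply: (network_distance_concentration (l2_layer_norms R) d0 k1 hMF hA hs rn0 mn0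
    hn hm hGammaB hmu hnu hXY hdelta K1).
  rewrite network_gainE//; set C := _ * \prod_(1 <= i < d) L i.
  have C0 : 0 < C * GammaB by rewrite /C -network_gainE// rest_ge0.
  rewrite [leRHS](_ : _ = C * GammaB * (Num.sqrt 2 * (2 * Num.sqrt (d%:R * ln 2) +
    Num.sqrt (ln (1 / delta)) + Num.sqrt 2)) *
    ((Num.sqrt n%:R)^-1 + (Num.sqrt m%:R)^-1)); last by rewrite /C; ring.
  apply: ler_wpM2r => //; apply: ler_wpM2l; first exact: ltW.
  (* Factoring out [sqrt 2], with [2 = sqrt 2 * sqrt 2], matches all terms except [d.-1] against [d]
     under the root. *)
  rewrite ln_pow2M// ln1 addr0 !sqrtrM//.
  have -> : Num.sqrt 2 * (2 * (Num.sqrt d%:R * Num.sqrt (ln 2)) +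
      Num.sqrt (ln (1 / delta)) + Num.sqrt 2) =
    2 * (Num.sqrt 2 * (Num.sqrt d%:R * Num.sqrt (ln 2))) +
    Num.sqrt 2 * Num.sqrt (ln (1 / delta)) + Num.sqrt (2 : R) ^+ 2 by ring.
  rewrite sqr_sqrtr// mulrDr mulr1 addrAC lerD2r lerD2r ler_pM2l//.
  rewrite ler_wpM2l ?sqrtr_ge0// ler_wpM2r ?sqrtr_ge0// ler_wsqrtr//.
  by rewrite ler_nat leq_pred.
- have kR : 1 <= (k 1%N)%:R :> R by rewrite ler1n.
  have K1 : 1 < 2 ^+ d.-1 * (k 1%N)%:R :> R.
    by rewrite (lt_le_trans pow_gt1)// ler_peMr// ltW// (lt_trans ltr01).
  have rn0 : l1norm (0 : 'cV[R]_(k d.-1.+1)) <= 0.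
    by rewrite /l1norm big1// => i _; rewrite mxE normr0.
  have mn0 p q : norm1oo (0 : 'M[R]_(p, q)) <= 0.
    by apply: bigmax_le => // i _; rewrite big1// => j _; rewrite mxE normr0.
  apply: (network_distance_concentration (linf_layer_norms R) d0 k1 hM1oo hA hs rn0 mn0
    hn hm hGammaB hmu hnu hXY hdelta K1).
  rewrite network_gainE//; set C := _ * \prod_(1 <= i < d) L i.
  have C0 : 0 < C * GammaB by rewrite /C -network_gainE// rest_ge0.
  rewrite [leRHS](_ : _ = C * GammaB * (4 * Num.sqrt (d%:R + 1 + ln (k 1%N)%:R) +
    Num.sqrt (2 * ln (1 / delta))) *
    ((Num.sqrt n%:R)^-1 + (Num.sqrt m%:R)^-1)); last by rewrite /C; ring.
  apply: ler_wpM2r => //; apply: ler_wpM2l; first exact: ltW.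
  rewrite lerD2r ln_pow2M ?(lt_le_trans ltr01)//.
  have lnk : 0 <= ln (k 1%N)%:R :> R by exact: ln_ge0.
  (* Here [y = ln K]. Since [ln 2 <= 1], [y + 2] is at most the stated radicand, so
     [sqrt (2 y) + 1 <= 2 sqrt (y + 2)] suffices; it follows by squaring and
     [2 sqrt (2 y) <= 2 y + 1]. *)
  set y := _ + ln (k 1%N)%:R.
  have y0 : 0 <= y by rewrite addr_ge0// mulr_ge0// ltW.
  have yd : y + 2 <= d%:R + 1 + ln (k 1%N)%:R.
    have : d.-1%:R * ln 2 <= d.-1%:R * 1 :> R by rewrite ler_wpM2l// ln2_le1.
    rewrite /y -[in d%:R](prednK d0) -natr1; lra.
  suff : Num.sqrt (2 * y) + 1 <= 2 * Num.sqrt (y + 2).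
    by have := @ler_wsqrtr R _ _ yd; lra.
  have h1 : Num.sqrt (2 * y) ^+ 2 = 2 * y by rewrite sqr_sqrtr// mulr_ge0.
  have h2 : Num.sqrt (y + 2) ^+ 2 = y + 2 by rewrite sqr_sqrtr// addr_ge0.
  rewrite -(@ler_pXn2r _ 2)// ?nnegrE ?addr_ge0 ?mulr_ge0 ?sqrtr_ge0//.
  by have := sqr_ge0 (Num.sqrt (2 * y) - 1); move: h1 h2; nra.
Qed.
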